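(* Even if a causal structure (with unrestricted gates) admits of a CPT-$T$ gap, not allowing for the preparation of a shared reference frame state among all latent GPT systems is still not a sufficient condition for it to admit of a swirled-nonswirled gap (even when the swirling is restricted to strongly nonphysical symmetries).
   Context: GPT. In a generalized probabilistic theory (GPT) $T$ each system is associated with a real vector space; states and effects are represented by vectors, transformations by linear maps, and the probability of an effect on a state is their Euclidean inner product. A GPT specifies which states, effects and transformations are valid. The GPTs $T$ considered are tomographically local, i.e. states of composite systems are determined by the statistics of local measurements on the components, and contain classical probability theory (CPT) as a subtheory. Swirling. A symmetry of $T$ is described by a group $G$ (taken discrete), with the action of $g\in G$ on each system $S$ represented by a map $\mathcal{F}^S_g$ that is reversible and preserves the inner product between states and effects; it acts collectively on composites, $\mathcal{F}^{AB}_g=\mathcal{F}^A_g\otimes\mathcal{F}^B_g$, and trivially on classical systems encoding settings and outcomes. It is nonphysical if some $\mathcal{F}^S_g$ is not a valid transformation of $T$, and strongly nonphysical if some $\mathcal{F}^S_g$ is not even logically possible, i.e. having it in $T$ would lead to a number outside $[0,1]$ where a probability is expected. For a nonphysical symmetry, the swirled version $sT$ of $T$ is the subtheory of $T$ whose states and effects are all and only the invariant ones and whose transformations are all and only the covariant ones ($\mathcal{E}\circ\mathcal{F}^A_g=\mathcal{F}^B_g\circ\mathcal{E}$ for all $g\in G$). Causal structures. An experiment is described by a circuit in which each wire is associated with a system and each gate with an operation. A causal structure specifies which systems can influence which others. All observed systems are classical; each latent (unobserved) system is either stipulated to be classical or is a GPT system, i.e. described by the GPT under consideration. ''With unrestricted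 gates'' means that no nontrivial no-influence conditions between inputs and outputs of a gate are imposed. A circuit is compatible with a causal structure if, for any two systems $A,B$ in the circuit, $A$ can influence $B$ in the circuit only if $A$ can influence $B$ in the causal structure. For a theory $T'$ (such as $T$, $sT$ or CPT), a probability distribution over the observed variables is $T'$-realizable in a causal structure if some circuit compatible with it yields the distribution when its latent GPT systems are described by $T'$. A causal structure admits of a $T'$-$T$ gap if its set of $T$-realizable distributions is a strict superset of its set of $T'$-realizable distributions. A swirled-nonswirled gap is an $sT$-$T$ gap. Shared reference frame state. A bipartite state $\rho^{AB}$ acts as a shared reference frame state if and only if its image under the symmetrization map $\frac{1}{|G|}\sum_{g\in G}\mathcal{F}^A_g\otimes\mathcal{F}^B_g$ is not invariant under the relational group action $\{\mathcal{I}^A\otimes\mathcal{F}^B_g\}_{g\in G}$, where $\mathcal{I}^A$ is the identity map (for strongly nonphysical symmetries this action is merely a mathematical operation); the notion extends analogously to multipartite states. In a symmetrized theory such a state is necessarily entangled, i.e. not preparable by local operations and shared classical randomness. A causal structure allows for the preparation of a shared reference frame state among all latent GPT systems if such a state among all of them can be prepared consistently with the causal structure; the causal structures that do not allow for this include those that have independent latent GPT systems and those that have latent GPT systems sharing only classical randomness. *)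

(* Defs.v *)
(* The field of real numbers is an arbitrary [realType]. *)
From HB Require Import structures.
From mathcomp Require Import all_boot all_order all_algebra all_fingroup.
From mathcomp Require Import boolp reals.

Set Implicit Arguments.
Unset Strict Implicit.
Unset Printing Implicit Defensive.
Import Order.TTheory GRing.Theory Num.Theory.
Local Open Scope ring_scope.

(** * Generalized probabilistic theories *)

(* The vector space of the system A is the space of real functions on the finite
   set [idx A].  The space of a composite system is the tensor product of the
   spaces of its components, hence the bijection between [idx (par A B)] and
   [idx A * idx B].  A linear map from A to B is given by its matrix: M (a, b) is
   the coefficient on b of the image of the basis vector a.  [cls n] is the
   classical system with n values and [unit_effect A] the effect that discards
   A.  This record holds only the data; [is_gpt] gives the conditions. *)
Record theory (R : realType) := Theory {
  sys : Type;
  idx : sys -> finType;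
  triv : sys;
  par : sys -> sys -> sys;
  cls : nat -> sys;
  triv0 : idx triv;
  pair_idx : forall A B, idx A -> idx B -> idx (par A B);
  split_idx : forall A B, idx (par A B) -> idx A * idx B;
  cls_val : forall n, idx (cls n) -> 'I_n;
  unit_effect : forall A, {ffun idx A -> R};
  valid : forall A B, {ffun idx A * idx B -> R} -> Prop
}.

Arguments triv {R t}.
Arguments par {R t} A B.
Arguments cls {R t} n.
Arguments triv0 {R t}.
Arguments pair_idx {R t A B} a b.
Arguments split_idx {R t A B} c.
Arguments cls_val {R t n} i.
Arguments unit_effect {R t} A.
Arguments valid {R t A B} M.

Definition vec (R : realType) (T : theory R) (A : sys T) := {ffun idx A -> R}.
Definition trans (R : realType) (T : theory R) (A B : sys T) :=
  {ffun idx A * idx B -> R}.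

Section Maps.
Context {R : realType} {T : theory R}.
Implicit Types A B C D : sys T.

Definition dot A (e v : vec A) : R := \sum_a e a * v a.

Definition app A B (M : trans A B) (v : vec A) : vec B :=
  [ffun b => \sum_a M (a, b) * v a].

Definition idt A : trans A A := [ffun p => (p.1 == p.2)%:R].

(* First M, then N. *)
Definition seqt A B C (M : trans A B) (N : trans B C) : trans A C :=
  [ffun p => \sum_b M (p.1, b) * N (b, p.2)].

Definition tens A B C D (M : trans A B) (N : trans C D) :
    trans (par A C) (par B D) :=
  [ffun p => M ((split_idx p.1).1, (split_idx p.2).1) *
             N ((split_idx p.1).2, (split_idx p.2).2)].

Definition tensv A B (v : vec A) (w : vec B) : vec (par A B) :=
  [ffun c => v (split_idx c).1 * w (split_idx c).2].

Definition relabel A B (f : idx A -> idx B) : trans A B :=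
  [ffun p => (f p.1 == p.2)%:R].

Definition swapf A B (c : idx (par A B)) : idx (par B A) :=
  pair_idx (split_idx c).2 (split_idx c).1.
Definition assocf A B C (c : idx (par (par A B) C)) : idx (par A (par B C)) :=
  pair_idx (split_idx (split_idx c).1).1
           (pair_idx (split_idx (split_idx c).1).2 (split_idx c).2).
Definition unassocf A B C (c : idx (par A (par B C))) : idx (par (par A B) C) :=
  pair_idx (pair_idx (split_idx c).1 (split_idx (split_idx c).2).1)
           (split_idx (split_idx c).2).2.

(* States and effects are the valid maps out of and into the trivial system. *)
Definition prep A (v : vec A) : trans triv A := [ffun p => v p.2].
Definition test A (e : vec A) : trans A triv := [ffun p => e p.1].
Definition is_state A (v : vec A) := valid (prep v).
Definition is_effect A (e : vec A) := valid (test e).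

Definition deterministic A B (M : trans A B) : Prop :=
  forall a, \sum_b M (a, b) * unit_effect B b = unit_effect A a.

Inductive classical : sys T -> Prop :=
| classical_triv : classical triv
| classical_cls n : classical (cls n)
| classical_par A B : classical A -> classical B -> classical (par A B).

Definition substochastic A B (M : trans A B) : Prop :=
  (forall p, 0 <= M p) /\ (forall a, \sum_b M (a, b) <= 1).

End Maps.

Arguments idt {R T} A.

Definition tomographically_local (R : realType) (T : theory R) : Prop :=
  forall (A B : sys T) (v w : vec (par A B)), is_state v -> is_state w ->
    (forall (e : vec A) (f : vec B), is_effect e -> is_effect f ->
       dot (tensv e f) v = dot (tensv e f) w) ->
    v = w.

(* Classical probability theory is a full subtheory: between classical systems,
   in the canonical basis, the valid transformations are exactly the
   substochastic matrices. *)
Definition contains_cpt (R : realType) (T : theory R) : Prop :=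
  (forall n, bijective (@cls_val R T n)) /\
  (forall (A B : sys T) (M : trans A B), classical A -> classical B ->
     valid M <-> substochastic M) /\
  (forall (A : sys T) a, classical A -> unit_effect A a = 1).

Record is_gpt (R : realType) (T : theory R) : Prop := IsGpt {
  gpt_triv : forall a : idx (@triv R T), a = triv0;
  gpt_pairK : forall (A B : sys T) (a : idx A) (b : idx B),
    split_idx (pair_idx a b) = (a, b);
  gpt_splitK : forall (A B : sys T) (c : idx (par A B)),
    pair_idx (split_idx c).1 (split_idx c).2 = c;
  gpt_id : forall A : sys T, valid (idt A);
  gpt_seq : forall (A B C : sys T) (M : trans A B) (N : trans B C),
    valid M -> valid N -> valid (seqt M N);
  gpt_tens : forall (A B C D : sys T) (M : trans A B) (N : trans C D),
    valid M -> valid N -> valid (tens M N);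
  gpt_swap : forall A B : sys T, valid (relabel (@swapf R T A B));
  gpt_assoc : forall A B C : sys T, valid (relabel (@assocf R T A B C));
  gpt_unassoc : forall A B C : sys T, valid (relabel (@unassocf R T A B C));
  gpt_unitl : forall A : sys T,
    valid (relabel (fun c : idx (par triv A) => (split_idx c).2));
  gpt_ununitl : forall A : sys T,
    valid (relabel (fun a : idx A => pair_idx (triv0 : idx (@triv R T)) a));
  gpt_convex : forall (A B : sys T) (M N : trans A B) (p : R),
    0 <= p <= 1 -> valid M -> valid N ->
    valid ([ffun x => p * M x + (1 - p) * N x] : trans A B);
  gpt_prob : forall (A : sys T) (v e : vec A),
    is_state v -> is_effect e -> 0 <= dot e v <= 1;
  gpt_unit : forall A : sys T, is_effect (unit_effect A);
  gpt_unit_par : forall A B : sys T,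
    unit_effect (par A B) = tensv (unit_effect A) (unit_effect B);
  gpt_local : tomographically_local T;
  gpt_cpt : contains_cpt T
}.

(* A theory T' living inside T: [sub_sys] are its systems and [sub_tr] its
   transformations, states and effects included. *)
Record subtheory (R : realType) (T : theory R) := Subtheory {
  sub_sys : sys T -> Prop;
  sub_tr : forall A B : sys T, trans A B -> Prop
}.

Definition whole (R : realType) (T : theory R) : subtheory T :=
  Subtheory (fun _ => True) (fun A B M => valid M).

Definition cpt (R : realType) (T : theory R) : subtheory T :=
  Subtheory (@classical R T)
            (fun A B M => [/\ classical A, classical B & valid M]).

(** * Symmetries and swirling *)

Record is_symmetry (R : realType) (T : theory R) (G : finGroupType)
    (F : G -> forall A : sys T, trans A A) : Prop := IsSymmetry {
  sym_1 : forall A, F 1%g A = idt A;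
  sym_M : forall g h A, F (g * h)%g A = seqt (F h A) (F g A);
  sym_dot : forall g A (e v : vec A), dot (app (F g A) e) (app (F g A) v) = dot e v;
  sym_par : forall g A B, F g (par A B) = tens (F g A) (F g B);
  sym_cls : forall g A, classical A -> F g A = idt A;
  sym_unit : forall g A, app (F g A) (unit_effect A) = unit_effect A;
  (* F is a symmetry of T: it maps valid processes to valid processes, although
     F g A itself need not be valid. *)
  sym_valid : forall g A B (M : trans A B), valid M ->
    valid (seqt (F g^-1%g A) (seqt M (F g B)))
}.

Definition nonphysical (R : realType) (T : theory R) (G : finGroupType)
    (F : G -> forall A : sys T, trans A A) : Prop :=
  exists g A, ~ valid (F g A).

(* The processes that can be built once X is added to those of T. *)
Inductive generated (R : realType) (T : theory R) (S : sys T) (X : trans S S) :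
    forall A B : sys T, trans A B -> Prop :=
| generated_valid A B (M : trans A B) : valid M -> generated X M
| generated_new : generated X X
| generated_seq A B C (M : trans A B) (N : trans B C) :
    generated X M -> generated X N -> generated X (seqt M N)
| generated_tens A B C D (M : trans A B) (N : trans C D) :
    generated X M -> generated X N -> generated X (tens M N).

Definition strongly_nonphysical (R : realType) (T : theory R) (G : finGroupType)
    (F : G -> forall A : sys T, trans A A) : Prop :=
  exists g A (M : trans (@triv R T) triv),
    generated (F g A) M /\ ~ (0 <= M (triv0, triv0) <= 1).

(* Since F acts trivially on [triv], covariance of [prep v] and of [test e] is
   invariance of v and of e: see [swirled_state] and [swirled_effect]. *)
Definition swirled (R : realType) (T : theory R) (G : finGroupType)
    (F : G -> forall A : sys T, trans A A) : subtheory T :=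
  Subtheory (fun _ => True)
    (fun A B M => valid M /\ forall g, seqt (F g A) M = seqt M (F g B)).

(** * Causal structures and circuits *)

(* Each system (wire) is the output of exactly one gate and an input of the
   gates in [dst w].  Gates without inputs are sources. *)
Record diagram (W : finType) := Diagram {
  gate : finType;
  src : W -> gate;
  dst : W -> {set gate}
}.

Section Diagram.
Context {W : finType}.
Variable D : diagram W.

Definition inputs (k : gate D) : seq W := enum [pred w | k \in dst D w].
Definition outputs (k : gate D) : seq W := enum [pred w | src D w == k].

(* Gates are unrestricted: every input can influence every output. *)
Definition influences : rel W := [rel v w | src D w \in dst D v].

Definition acyclic : Prop :=
  forall v w, influences v w -> ~~ connect influences w v.

End Diagram.

(* A causal structure with unrestricted gates on observed systems [obs], latent
   classical systems [lcls] and latent GPT systems [lgpt].  Classical systems can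
   be copied to several gates, a GPT system goes to a single gate (which is a
   mere discarding if it has no outputs). *)
Record causal_structure := CausalStructure {
  obs : finType;
  lcls : finType;
  lgpt : finType;
  shape : diagram (obs + lcls + lgpt)%type;
  shape_acyclic : acyclic shape;
  shape_linear : forall l : lgpt, #|dst shape (inr l)| = 1%N
}.

Definition wire (S : causal_structure) : finType := (obs S + lcls S + lgpt S)%type.

Section Circuit.
Context {R : realType} {T : theory R}.

Definition big_par (As : seq (sys T)) : sys T := foldr par triv As.

Definition wire_sys (S : causal_structure) (n : obs S -> nat) (m : lcls S -> nat)
    (Q : lgpt S -> sys T) (w : wire S) : sys T :=
  match w with
  | inl (inl o) => cls (n o)
  | inl (inr l) => cls (m l)
  | inr l => Q l
  end.

(* The basis index of a composite with components i w. *)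
Fixpoint pack (W : Type) (ty : W -> sys T) (i : forall w, idx (ty w)) (ws : seq W) :
    idx (big_par [seq ty w | w <- ws]) :=
  match ws return idx (big_par [seq ty w | w <- ws]) with
  | [::] => triv0
  | w :: ws' => pair_idx (i w) (pack i ws')
  end.

(* A circuit on the systems of S, where the observed system o has n o values.
   Its wiring is its own and need not be that of S; it is acyclic as soon as the
   circuit is compatible with S. *)
Record circuit (S : causal_structure) (n : obs S -> nat) := Circuit {
  lcls_size : lcls S -> nat;
  lgpt_sys : lgpt S -> sys T;
  wiring : diagram (wire S);
  wiring_linear : forall l : lgpt S, #|dst wiring (inr l)| = 1%N;
  op : forall k : gate wiring,
    trans (big_par [seq wire_sys n lcls_size lgpt_sys w | w <- inputs k])
          (big_par [seq wire_sys n lcls_size lgpt_sys w | w <- outputs k])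
}.

Section CircuitTheory.
Variables (S : causal_structure) (n : obs S -> nat) (C : circuit n).

Definition wsys : wire S -> sys T := wire_sys n (lcls_size C) (lgpt_sys C).

(* The second condition says that a gate is a common cause of its outputs:
   systems emitted jointly by the circuit are emitted jointly in S, so that,
   e.g., independent sources of S remain independent. *)
Definition compatible : Prop :=
  (forall v w, influences (wiring C) v w -> influences (shape S) v w) /\
  (forall v w, src (wiring C) v = src (wiring C) w ->
     src (shape S) v = src (shape S) w).

(* All gates are deterministic; outcomes are recorded on classical outputs. *)
Definition circuit_of (T' : subtheory T) : Prop :=
  (forall l, sub_sys T' (lgpt_sys C l)) /\
  (forall k : gate (wiring C), sub_tr T' (op k) /\ deterministic (op k)).

Definition assignment : finType := {dffun forall w : wire S, idx (wsys w)}.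

Definition gate_weight (i : assignment) (k : gate (wiring C)) : R :=
  op k (pack (fun w => i w) (inputs k), pack (fun w => i w) (outputs k)).

(* Contraction of the circuit along all wires; a classical wire entering several
   gates is copied, i.e. these gates share its index. *)
Definition circuit_prob (x : {dffun forall o : obs S, 'I_(n o)}) : R :=
  \sum_(i : assignment | [forall o : obs S, cls_val (i (inl (inl o))) == x o])
    \prod_k gate_weight i k.

(* A cut is a set K of gates closed under predecessors; it describes a stage of
   the experiment at which exactly the gates in K have been performed. *)
Definition cut (K : {set gate (wiring C)}) : Prop :=
  forall w k, k \in K -> k \in dst (wiring C) w -> src (wiring C) w \in K.

Definition frontier (K : {set gate (wiring C)}) : {set lgpt S} :=
  [set l | (src (wiring C) (inr l) \in K) &&
           [disjoint dst (wiring C) (inr l) & K]].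

Definition full_cut (K : {set gate (wiring C)}) : Prop :=
  cut K /\ forall K', cut K' -> frontier K \subset frontier K' ->
             frontier K' = frontier K.

Definition frontier_wires (K : {set gate (wiring C)}) : seq (wire S) :=
  [seq inr l | l <- enum (frontier K)].

(* The state of the latent GPT systems in the frontier of K, all classical
   systems being marginalized.  Nothing depends on the wires not yet produced:
   the sum over their indices is normalized away. *)
Definition frontier_state (K : {set gate (wiring C)}) :
    vec (big_par [seq wsys w | w <- frontier_wires K]) :=
  [ffun j => \sum_(i : assignment | pack (fun w => i w) (frontier_wires K) == j)
     (\prod_(k in K) gate_weight i k) *
     \prod_(w | src (wiring C) w \notin K) (#|idx (wsys w)|%:R)^-1].

End CircuitTheory.

Definition is_distribution (I : finType) (P : I -> R) : Prop :=
  (forall x, 0 <= P x) /\ \sum_x P x = 1.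

Definition realizable (T' : subtheory T) (S : causal_structure) (n : obs S -> nat)
    (P : {dffun forall o : obs S, 'I_(n o)} -> R) : Prop :=
  is_distribution P /\
  exists C : circuit n,
    [/\ compatible C, circuit_of C T' & forall x, circuit_prob C x = P x].

(* S admits of a T1-T2 gap. *)
Definition admits_gap (S : causal_structure) (T1 T2 : subtheory T) : Prop :=
  (forall n (P : {dffun forall o : obs S, 'I_(n o)} -> R),
     realizable T1 P -> realizable T2 P) /\
  (exists n (P : {dffun forall o : obs S, 'I_(n o)} -> R),
     realizable T2 P /\ ~ realizable T1 P).

(** * Shared reference frame states *)

Section SharedFrame.
Variables (G : finGroupType) (F : G -> forall A : sys T, trans A A).
Variables (W : finType) (ty : W -> sys T).

(* g acts on the components in D and the identity map acts on the others. *)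
Fixpoint part_act (g : G) (D : {set W}) (ws : seq W) :
    trans (big_par [seq ty w | w <- ws]) (big_par [seq ty w | w <- ws]) :=
  match ws return trans (big_par [seq ty w | w <- ws])
                        (big_par [seq ty w | w <- ws]) with
  | [::] => idt triv
  | w :: ws' => tens (if w \in D then F g (ty w) else idt (ty w))
                     (part_act g D ws')
  end.

Definition symmetrize (ws : seq W) (v : vec (big_par [seq ty w | w <- ws])) :
    vec (big_par [seq ty w | w <- ws]) :=
  [ffun j => (#|G|%:R)^-1 * \sum_(g : G) app (part_act g [set: W] ws) v j].

(* For two components this says that the symmetrized state is not invariant
   under {id (x) F g}.  A multipartite state is a frame shared among all of its
   components if this holds for every splitting into two nonempty groups. *)
Definition shared_frame (ws : seq W) (v : vec (big_par [seq ty w | w <- ws])) : Prop :=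
  forall D : {set W}, has (mem D) ws -> has (mem (~: D)) ws ->
    exists g, app (part_act g D ws) (symmetrize v) <> symmetrize v.

End SharedFrame.

(* The preparation is made within the symmetrized theory.  When no latent GPT
   system influences another (directly or not), the frontier of a full cut
   consists of all of them; otherwise, all maximal families of coexisting latent
   GPT systems are considered. *)
Definition allows_shared_frame (G : finGroupType)
    (F : G -> forall A : sys T, trans A A) (S : causal_structure) : Prop :=
  exists (n : obs S -> nat) (C : circuit n),
    [/\ compatible C, circuit_of C (swirled F) &
        forall K : {set gate (wiring C)}, full_cut K -> shared_frame F (frontier_state K)].

End Circuit.

(** * Basic facts *)

Section Facts.
Context {R : realType} {T : theory R} {G : finGroupType}.
Variable F : G -> forall A : sys T, trans A A.
Hypotheses (hT : is_gpt T) (hF : is_symmetry F).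

Lemma sum_triv (f : idx (@triv R T) -> R) : \sum_a f a = f triv0.
Proof.
rewrite (bigD1 triv0) //= big1 ?addr0 // => a.
by rewrite (gpt_triv hT a) eqxx.
Qed.

Lemma swirled_state (A : sys T) (v : vec A) :
  sub_tr (swirled F) (prep v) <-> is_state v /\ forall g, app (F g A) v = v.
Proof.
have eqv g : seqt (F g triv) (prep v) = seqt (prep v) (F g A) <-> app (F g A) v = v.
  rewrite (sym_cls hF g (@classical_triv R T)); split => [/ffunP e|/ffunP e];
    apply/ffunP => p.
  - move: (e (triv0, p)); rewrite !ffunE sum_triv !ffunE eqxx mul1r /= => ->.
    by apply: eq_bigr => a _; rewrite !ffunE mulrC.
  - move: (e p.2); rewrite !ffunE sum_triv !ffunE (gpt_triv hT p.1) eqxx mul1r /= => <-.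
    by apply: eq_bigr => a _; rewrite !ffunE mulrC.
by split=> [[? h]|[? h]]; split => // g; apply/eqv.
Qed.

Lemma swirled_effect (A : sys T) (e : vec A) :
  sub_tr (swirled F) (test e) <-> is_effect e /\ forall g, app (F g A) e = e.
Proof.
have pull g : seqt (F g A) (test e) = test (app (F g^-1%g A) e).
  apply/ffunP => [[a t]]; rewrite !ffunE /=.
  have := sym_dot hF g (app (F g^-1%g A) e) [ffun x => (x == a)%:R].
  have -> : app (F g A) (app (F g^-1%g A) e) = e.
    apply/ffunP => b; rewrite !ffunE.
    have := sym_M hF g g^-1%g A; rewrite mulgV (sym_1 hF) => /ffunP E.
    transitivity (\sum_c (idt A) (c, b) * e c); last first.
      rewrite (bigD1 b) //= big1 ?addr0 => [|c /negPf nc]; rewrite !ffunE /=.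
        by rewrite eqxx mul1r.
      by rewrite nc mul0r.
    under [RHS]eq_bigr => c _ do rewrite E ffunE /= mulr_suml.
    rewrite exchange_big /=; apply: eq_bigr => c _.
    rewrite ffunE mulr_sumr; apply: eq_bigr => d _.
    by rewrite mulrA [F g A _ * _]mulrC.
  have dl (B : sys T) (w : vec B) (b : idx B) : dot w [ffun x => (x == b)%:R] = w b.
    rewrite /dot (bigD1 b) //= big1 ?addr0 => [|c /negPf nc]; rewrite !ffunE.
      by rewrite eqxx mulr1.
    by rewrite nc mulr0.
  rewrite dl !ffunE => <-; apply: eq_bigr => b _; rewrite !ffunE mulrC; congr (_ * _).
  rewrite (bigD1 a) //= big1 ?addr0 => [|c /negPf nc]; rewrite !ffunE.
    by rewrite eqxx mulr1.
  by rewrite nc mulr0.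
have eqv g : seqt (F g A) (test e) = seqt (test e) (F g triv) <->
    app (F g^-1%g A) e = e.
  have idr : seqt (test e) (F g triv) = test e.
    rewrite (sym_cls hF g (@classical_triv R T)); apply/ffunP => p.
    by rewrite !ffunE sum_triv !ffunE (gpt_triv hT p.2) eqxx mulr1.
  rewrite pull idr; split => [/ffunP h|-> //]; apply/ffunP => a.
  by move: (h (a, triv0)); rewrite !ffunE.
split=> [[? h]|[? h]]; split => // g; last by apply/eqv.
by rewrite -[g]invgK; apply/eqv.
Qed.

Lemma strongly_nonphysicalW : strongly_nonphysical F -> nonphysical F.
Proof.
move=> [g [A [M [genM badM]]]]; exists g, A => validF; apply: badM.
have gen_valid B C (N : trans B C) : generated (F g A) N -> valid N.
  by elim => // *; [exact: (gpt_seq hT)|exact: (gpt_tens hT)].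
have {genM} validM := gen_valid _ _ _ genM.
have := @gpt_prob _ _ hT triv [ffun a => M (triv0, a)] (unit_effect triv).
rewrite /dot sum_triv ffunE.
have [_ [_ ->]] := gpt_cpt hT; last exact: classical_triv.
rewrite mul1r; apply; last exact: (gpt_unit hT).
rewrite /is_state; suff -> : prep [ffun a => M (triv0, a)] = M by [].
by apply/ffunP => [[a b]]; rewrite !ffunE /= (gpt_triv hT a).
Qed.

End Facts.

(* Main.v *)
Require Import Defs.
From HB Require Import structures.
From mathcomp Require Import all_boot all_order all_algebra all_fingroup.
From mathcomp Require Import boolp reals.
From mathcomp Require Import ring lra.

(* The theory T has three kinds of elementary systems: classical systems; gbits,
   whose composites carry all nonsignalling states and hence PR boxes; and hidden
   trits.  A hidden trit is a classical trit on which the symmetry group Z/2 acts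
   by the reflection J = 2/3 (all ones) - 1 about the uniform vector; a
   process is valid only if its conjugate by the symmetry is positive as well.
   Two perfectly correlated trits, and the test that they are equal, are invariant
   under J (x) J, but J on one side yields the number tr J / 3 = - 1/3, so the
   symmetry is strongly nonphysical.

   Replacing each system by a copy on which the symmetry acts trivially turns
   every circuit of T into a circuit of sT with the same probabilities: this T has
   no sT-T gap in any causal structure.  The causal structure is the Bell scenario
   together with one more latent GPT system from an independent source.  The PR
   box gives a CPT-T gap.  The state of the independent system is invariant and
   factors out of the state of all latent systems, so no frame is shared. *)

Set Implicit Arguments.
Unset Strict Implicit.
Unset Printing Implicit Defensive.
Import Order.TTheory GRing.Theory Num.Theory.
Local Open Scope ring_scope.

Section Matrices.
Context {R : realType}.
Implicit Types I J K L : finType.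

Definition scalev I (c : R) (f : {ffun I -> R}) : {ffun I -> R} :=
  [ffun a => c * f a].
Local Notation "c *' f" := (scalev c f) (at level 40, left associativity).

Definition mid I : {ffun I * I -> R} := [ffun p => (p.1 == p.2)%:R].

Definition mmul I J K (M : {ffun I * J -> R}) (N : {ffun J * K -> R}) :
    {ffun I * K -> R} :=
  [ffun p => \sum_b M (p.1, b) * N (b, p.2)].

Definition mtens I J K L (M : {ffun I * J -> R}) (N : {ffun K * L -> R}) :
    {ffun (I * K) * (J * L) -> R} :=
  [ffun p => M (p.1.1, p.2.1) * N (p.1.2, p.2.2)].

Definition vtens I J (v : {ffun I -> R}) (w : {ffun J -> R}) :
    {ffun I * J -> R} :=
  [ffun p => v p.1 * w p.2].

Definition mrel I J (f : I -> J) : {ffun I * J -> R} :=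
  [ffun p => (f p.1 == p.2)%:R].

Definition pull I J (M : {ffun I * J -> R}) (f : {ffun J -> R}) :
    {ffun I -> R} :=
  [ffun a => \sum_b M (a, b) * f b].

Definition basisv I (a : I) : {ffun I -> R} := [ffun b => (a == b)%:R].

Lemma sum_eql I (a : I) (f : I -> R) : \sum_b (a == b)%:R * f b = f a.
Proof.
rewrite (bigD1 a) //= eqxx mul1r big1 ?addr0 // => b /negPf nb.
by rewrite eq_sym nb mul0r.
Qed.

Lemma sum_eqr I (a : I) (f : I -> R) : \sum_b f b * (b == a)%:R = f a.
Proof.
by rewrite -[RHS](sum_eql a); apply: eq_bigr => b _; rewrite mulrC eq_sym.
Qed.

Lemma pull_id I (f : {ffun I -> R}) : pull (mid I) f = f.
Proof.
by apply/ffunP => a; rewrite ffunE; under eq_bigr do rewrite ffunE /=; rewrite sum_eql.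
Qed.

Lemma pull_rel I J (h : I -> J) (f : {ffun J -> R}) :
  pull (mrel h) f = [ffun a => f (h a)].
Proof.
by apply/ffunP => a; rewrite !ffunE; under eq_bigr do rewrite ffunE /=; rewrite sum_eql.
Qed.

Lemma pull_mul I J K (M : {ffun I * J -> R}) (N : {ffun J * K -> R}) f :
  pull (mmul M N) f = pull M (pull N f).
Proof.
apply/ffunP => a; rewrite !ffunE.
under eq_bigr do rewrite ffunE mulr_suml.
rewrite exchange_big; apply: eq_bigr => b _ /=.
by rewrite ffunE mulr_sumr; apply: eq_bigr => c _; rewrite mulrA.
Qed.

Lemma pull_tens I J K L (M : {ffun I * J -> R}) (N : {ffun K * L -> R}) f g :
  pull (mtens M N) (vtens f g) = vtens (pull M f) (pull N g).
Proof.
apply/ffunP => [[a c]]; rewrite !ffunE /= mulr_suml.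
under [RHS]eq_bigr do rewrite mulr_sumr.
rewrite pair_big /=; apply: eq_bigr => [[b d] _]; rewrite !ffunE /=; ring.
Qed.

Lemma pullD I J (M : {ffun I * J -> R}) f g : pull M (f + g) = pull M f + pull M g.
Proof.
apply/ffunP => a; rewrite !ffunE -big_split.
by apply: eq_bigr => b _; rewrite ffunE mulrDr.
Qed.

Lemma pullZ I J (M : {ffun I * J -> R}) c f : pull M (c *' f) = c *' pull M f.
Proof.
apply/ffunP => a; rewrite !ffunE mulr_sumr.
by apply: eq_bigr => b _; rewrite ffunE mulrCA.
Qed.

Lemma pullN I J (M : {ffun I * J -> R}) f : pull M (- f) = - pull M f.
Proof.
apply/ffunP => a; rewrite !ffunE -sumrN.
by apply: eq_bigr => b _; rewrite ffunE mulrN.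
Qed.

Lemma scalev1 I (f : {ffun I -> R}) : 1 *' f = f.
Proof. by apply/ffunP => a; rewrite ffunE mul1r. Qed.

Lemma scalevDl I c d (f : {ffun I -> R}) : (c + d) *' f = c *' f + d *' f.
Proof. by apply/ffunP => a; rewrite !ffunE mulrDl. Qed.

Lemma pull_lin I J (c d : R) (M N : {ffun I * J -> R}) f :
  pull [ffun x => c * M x + d * N x] f = c *' pull M f + d *' pull N f.
Proof.
apply/ffunP => a; rewrite !ffunE !mulr_sumr -big_split.
by apply: eq_bigr => b _; rewrite ffunE /=; ring.
Qed.

Lemma pull_basis I J (M : {ffun I * J -> R}) a b : pull M (basisv b) a = M (a, b).
Proof.
by rewrite ffunE; under eq_bigr do rewrite ffunE [b == _]eq_sym; rewrite sum_eqr.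
Qed.

Lemma pull_inj I J (M N : {ffun I * J -> R}) : (forall f, pull M f = pull N f) -> M = N.
Proof. by move=> e; apply/ffunP => [[a b]]; rewrite -!pull_basis e. Qed.

Lemma mmulA I J K L (M : {ffun I * J -> R}) (N : {ffun J * K -> R})
    (P : {ffun K * L -> R}) : mmul M (mmul N P) = mmul (mmul M N) P.
Proof. by apply: pull_inj => f; rewrite !pull_mul. Qed.

Lemma mmul1 I J (M : {ffun I * J -> R}) : mmul (mid I) M = M.
Proof. by apply: pull_inj => f; rewrite pull_mul pull_id. Qed.

Lemma mmulr1 I J (M : {ffun I * J -> R}) : mmul M (mid J) = M.
Proof. by apply: pull_inj => f; rewrite pull_mul pull_id. Qed.

Lemma mtens_mul I J K I' J' K' (M : {ffun I * J -> R}) (N : {ffun J * K -> R})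
    (M' : {ffun I' * J' -> R}) (N' : {ffun J' * K' -> R}) :
  mtens (mmul M N) (mmul M' N') = mmul (mtens M M') (mtens N N').
Proof.
apply/ffunP => [[[a a'] [c c']]]; rewrite !ffunE /= mulr_suml.
under [LHS]eq_bigr do rewrite mulr_sumr.
rewrite pair_big /=; apply: eq_bigr => [[b b'] _]; rewrite !ffunE /=; ring.
Qed.

Lemma mtens_id I J : mtens (mid I) (mid J) = mid (I * J)%type.
Proof.
by apply/ffunP => [[[a b] [c d]]]; rewrite !ffunE /= -natrM mulnb.
Qed.

Lemma mtens_rel I J K L (f : I -> J) (g : K -> L) :
  mtens (mrel f) (mrel g) = mrel (fun p => (f p.1, g p.2)).
Proof.
by apply/ffunP => [[[a b] [c d]]]; rewrite !ffunE /= -natrM mulnb.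
Qed.

Lemma vtens_sum I J (v : {ffun I * J -> R}) :
  v = \sum_p vtens (v p *' basisv p.1) (basisv p.2).
Proof.
apply/ffunP => q; rewrite sum_ffunE -[LHS](sum_eqr q).
apply: eq_bigr => [[a b]] _; rewrite !ffunE /= -mulrA -natrM mulnb.
by case: q.
Qed.

End Matrices.

Notation "c *' f" := (scalev c f) (at level 40, left associativity).

Section Cones.
Context {R : realType}.

(* The smallest tensor product of the effect cones, that is, the largest one of
   the state spaces. *)
Inductive tcone (I J : finType) (K : {ffun I -> R} -> Prop) (L : {ffun J -> R} -> Prop) :
    {ffun I * J -> R} -> Prop :=
| tcone_prod e f : K e -> L f -> tcone K L (vtens e f)
| tcone_add v w : tcone K L v -> tcone K L w -> tcone K L (v + w)
| tcone_scale c v : 0 <= c -> tcone K L v -> tcone K L (c *' v).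

(* A system is given by its cone of unnormalized effects; the states are the
   normalized vectors of the dual cone.  The symmetry acts by [refl]. *)
Record boxsys := Boxsys {
  carrier : finType;
  cone : {ffun carrier -> R} -> Prop;
  unitv : {ffun carrier -> R};
  refl : {ffun carrier * carrier -> R};
  cone_add : forall e f, cone e -> cone f -> cone (e + f);
  cone_scale : forall c e, 0 <= c -> cone e -> cone (c *' e);
  cone_unit : cone unitv;
  cone_order_unit : forall x, exists2 N : R, 0 < N & cone (N *' unitv + x);
  refl_sym : forall a b, refl (a, b) = refl (b, a);
  refl_invol : mmul refl refl = mid carrier;
  refl_unit : pull refl unitv = unitv
}.

Lemma cone0 A : @cone A 0.
Proof.
have -> : 0 = 0 *' unitv A by apply/ffunP => a; rewrite !ffunE mul0r.
by apply: cone_scale => //; exact: cone_unit.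
Qed.

Lemma cone_sum A (I : finType) (e : I -> {ffun carrier A -> R}) :
  (forall i, cone (e i)) -> cone (\sum_i e i).
Proof. by move=> h; elim/big_ind: _ => //; [exact: cone0|exact: cone_add]. Qed.

Lemma order_unit2 A (x : {ffun carrier A -> R}) :
  exists2 N : R, 0 < N & cone (N *' unitv A + x) /\ cone (N *' unitv A - x).
Proof.
have [N N0 h] := cone_order_unit x; have [M M0 k] := cone_order_unit (- x).
exists (N + M); first exact: addr_gt0.
split; rewrite scalevDl; last rewrite [N *' _ + _]addrC.
all: rewrite addrAC; apply: cone_add => //.
all: by apply: cone_scale (cone_unit A); exact: ltW.
Qed.

Definition order_unit (I : finType) (K : {ffun I -> R} -> Prop) (u : {ffun I -> R}) :=
  forall x, exists2 N : R, 0 < N & K (N *' u + x).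

Section Par.
Variables A B : boxsys.
Notation car := (carrier A * carrier B)%type.
Let K := tcone (@cone A) (@cone B).
Let u := vtens (unitv A) (unitv B).
Let J := mtens (refl A) (refl B).

Lemma par_unit : K u.
Proof. by apply: tcone_prod; exact: cone_unit. Qed.

Lemma par_order_unit : order_unit K u.
Proof.
move=> x; rewrite [x]vtens_sum; elim/big_ind: _.
- by exists 1 => //; rewrite addr0 scalev1; exact: par_unit.
- move=> y z [N N0 hN] [M M0 hM]; exists (N + M); first exact: addr_gt0.
  by rewrite scalevDl addrACA; apply: tcone_add.
- move=> p _; move: (x p *' _) (basisv p.2) => y z.
  have [N N0 [h1 h2]] := order_unit2 y; have [M M0 [k1 k2]] := order_unit2 z.
  exists (N * M); first exact: mulr_gt0.
  have -> : (N * M) *' u + vtens y z = 2^-1 *'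
      (vtens (N *' unitv A + y) (M *' unitv B + z) +
       vtens (N *' unitv A - y) (M *' unitv B - z)).
    by apply/ffunP => q; rewrite !ffunE /=; field.
  apply: tcone_scale; first by rewrite invr_ge0.
  by apply: tcone_add; apply: tcone_prod.
Qed.

Lemma par_refl_sym a b : J (a, b) = J (b, a).
Proof. by rewrite !ffunE /= refl_sym [refl B _]refl_sym. Qed.

Lemma par_refl_invol : mmul J J = mid car.
Proof. by rewrite -mtens_mul !refl_invol mtens_id. Qed.

Lemma par_refl_unit : pull J u = u.
Proof. by rewrite pull_tens !refl_unit. Qed.

Definition box_par : boxsys :=
  @Boxsys car K u J (@tcone_add _ _ _ _) (@tcone_scale _ _ _ _) par_unit
    par_order_unit par_refl_sym par_refl_invol par_refl_unit.

End Par.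

Definition nonneg (I : finType) (f : {ffun I -> R}) := forall a, 0 <= f a.

Lemma nonneg_add (I : finType) (e f : {ffun I -> R}) : nonneg e -> nonneg f -> nonneg (e + f).
Proof. by move=> h k a; rewrite ffunE addr_ge0. Qed.

Lemma nonneg_scale (I : finType) (c : R) (e : {ffun I -> R}) :
  0 <= c -> nonneg e -> nonneg (c *' e).
Proof. by move=> h k a; rewrite ffunE; apply: mulr_ge0. Qed.

Definition onev (I : finType) : {ffun I -> R} := [ffun=> 1].

Lemma nonneg_one (I : finType) : nonneg (onev I).
Proof. by move=> a; rewrite ffunE. Qed.

Lemma nonneg_order_unit (I : finType) : order_unit (@nonneg I) (onev I).
Proof.
move=> x; exists (1 + \sum_a `|x a|); first by rewrite ltr_pwDl // sumr_ge0.
move=> a; rewrite !ffunE /= mulr1 (bigD1 a) //=.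
have : 0 <= \sum_(i | i != a) `|x i| by exact: sumr_ge0.
by have := ler_norm (- x a); rewrite normrN; lra.
Qed.

Lemma mid_sym (I : finType) (a b : I) : mid I (a, b) = mid I (b, a) :> R.
Proof. by rewrite !ffunE eq_sym. Qed.

Definition box_simplex (I : finType) (J : {ffun I * I -> R})
    (Js : forall a b, J (a, b) = J (b, a)) (JJ : mmul J J = mid I)
    (Ju : pull J (onev I) = onev I) : boxsys :=
  Boxsys (@nonneg_add I) (@nonneg_scale I) (@nonneg_one I) (@nonneg_order_unit I) Js JJ Ju.

Definition box_cls_on (I : finType) : boxsys :=
  @box_simplex I (mid I) (@mid_sym I) (mmul1 _) (pull_id _).
Definition box_cls n : boxsys := box_cls_on 'I_n.
Definition box_triv : boxsys := box_cls_on unit.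

Definition unrefl (A : boxsys) : boxsys :=
  Boxsys (@cone_add A) (@cone_scale A) (@cone_unit A) (@cone_order_unit A)
    (@mid_sym (carrier A)) (mmul1 _) (pull_id _).

Definition positive_map (A B : boxsys) (M : {ffun carrier A * carrier B -> R}) :=
  (forall f, cone f -> cone (pull M f)) /\ cone (unitv A - pull M (unitv B)).

Definition twist (A B : boxsys) (M : {ffun carrier A * carrier B -> R}) :
    {ffun carrier A * carrier B -> R} := mmul (refl A) (mmul M (refl B)).

Definition box_valid (A B : boxsys) (M : {ffun carrier A * carrier B -> R}) :=
  positive_map M /\ positive_map (twist M).

Definition boxT : theory R :=
  @Theory R boxsys carrier box_triv box_par box_cls tt
    (fun _ _ a b => (a, b)) (fun _ _ c => c) (fun n i => i) unitv box_valid.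

Lemma twist_id (A : boxsys) : twist (A := A) (B := A) (mid _) = mid _.
Proof. by rewrite /twist mmul1 refl_invol. Qed.

Lemma twist_mul (A B C : boxsys) (M : {ffun carrier A * carrier B -> R})
    (N : {ffun carrier B * carrier C -> R}) :
  twist (A := A) (B := C) (mmul M N) = mmul (twist M) (twist N).
Proof.
by rewrite /twist !mmulA -[mmul (mmul (mmul _ _) (refl B)) (refl B)]mmulA refl_invol mmulr1.
Qed.

Lemma twist_tens (A B C D : boxsys) (M : {ffun carrier A * carrier B -> R})
    (N : {ffun carrier C * carrier D -> R}) :
  twist (A := box_par A C) (B := box_par B D) (mtens M N) = mtens (twist M) (twist N).
Proof. by rewrite /twist /= !mtens_mul. Qed.

Lemma twistK (A B : boxsys) (M : {ffun carrier A * carrier B -> R}) :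
  twist (A := A) (B := B) (twist M) = M.
Proof.
by rewrite /twist !mmulA refl_invol mmul1 -mmulA refl_invol mmulr1.
Qed.

Lemma twist_rel (A B : boxsys) (f : carrier A -> carrier B) (g : carrier B -> carrier A) :
  cancel f g -> cancel g f -> (forall a b, refl B (f a, f b) = refl A (a, b)) ->
  twist (A := A) (B := B) (mrel f) = mrel f.
Proof.
move=> fK gK e; suff h : mmul (refl A) (mrel f) = mmul (mrel f) (refl B).
  by rewrite /twist mmulA h -mmulA refl_invol mmulr1.
apply/ffunP => [[a b]]; rewrite !ffunE /=.
transitivity (refl A (a, g b)).
  rewrite -(sum_eqr (g b) (fun c => refl A (a, c))); apply: eq_bigr => c _.
  by rewrite ffunE /= -{1}[b]gK (can_eq fK).
rewrite -e gK -(sum_eql (f a) (fun c => refl B (c, b))).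
by apply: eq_bigr => c _; rewrite ffunE.
Qed.

Lemma twist_lin (A B : boxsys) (c d : R) (M N : {ffun carrier A * carrier B -> R}) :
  twist (A := A) (B := B) [ffun x => c * M x + d * N x] =
  [ffun x => c * twist M x + d * twist N x].
Proof.
apply: pull_inj => f; rewrite pull_lin /twist !pull_mul pull_lin.
by rewrite !(pullD, pullZ).
Qed.

Lemma positive_id (A : boxsys) : positive_map (A := A) (B := A) (mid _).
Proof. by split=> [f|]; rewrite pull_id // subrr; exact: cone0. Qed.

Lemma positive_mul (A B C : boxsys) (M : {ffun carrier A * carrier B -> R})
    (N : {ffun carrier B * carrier C -> R}) :
  positive_map M -> positive_map N -> positive_map (A := A) (B := C) (mmul M N).
Proof.
move=> [M1 M2] [N1 N2]; split=> [f cf|]; rewrite pull_mul; first by apply/M1/N1.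
have -> : unitv A - pull M (pull N (unitv C)) =
  (unitv A - pull M (unitv B)) + pull M (unitv B - pull N (unitv C)).
  by rewrite pullD pullN addrA subrK.
by apply: cone_add => //; exact: M1.
Qed.

Lemma positive_tens (A B C D : boxsys) (M : {ffun carrier A * carrier B -> R})
    (N : {ffun carrier C * carrier D -> R}) :
  positive_map M -> positive_map N ->
  positive_map (A := box_par A C) (B := box_par B D) (mtens M N).
Proof.
move=> [M1 M2] [N1 N2]; split=> [f|].
  elim=> [e g ce cg|v w _ hv _ hw|c v c0 _ hv].
  - by rewrite pull_tens; apply: tcone_prod; [exact: M1|exact: N1].
  - by rewrite pullD; exact: tcone_add.
  - by rewrite pullZ; exact: tcone_scale.
rewrite /= pull_tens.
have -> : vtens (unitv A) (unitv C) - vtens (pull M (unitv B)) (pull N (unitv D)) =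
  vtens (unitv A - pull M (unitv B)) (unitv C) +
  vtens (pull M (unitv B)) (unitv C - pull N (unitv D)).
  by apply/ffunP => q; rewrite !ffunE; ring.
apply: tcone_add; apply: tcone_prod => //; first exact: cone_unit.
exact/M1/cone_unit.
Qed.

Lemma positive_rel (A B : boxsys) (h : carrier A -> carrier B) :
  (forall f, cone f -> cone [ffun a => f (h a)]) ->
  (forall a, unitv B (h a) = unitv A a) -> positive_map (mrel h).
Proof.
move=> h1 h2; split=> [f cf|]; rewrite pull_rel; first exact: h1.
suff -> : [ffun a => unitv B (h a)] = unitv A by rewrite subrr; exact: cone0.
by apply/ffunP => a; rewrite ffunE.
Qed.

Lemma positive_lin (A B : boxsys) (p : R) (M N : {ffun carrier A * carrier B -> R}) :
  0 <= p <= 1 -> positive_map M -> positive_map N ->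
  positive_map (A := A) (B := B) [ffun x => p * M x + (1 - p) * N x].
Proof.
move=> /andP[p0 p1] [M1 M2] [N1 N2].
have q0 : 0 <= 1 - p by rewrite subr_ge0.
split=> [f cf|]; rewrite pull_lin.
  by apply: cone_add; apply: cone_scale => //; [exact: M1|exact: N1].
have -> : unitv A - (p *' pull M (unitv B) + (1 - p) *' pull N (unitv B)) =
  p *' (unitv A - pull M (unitv B)) + (1 - p) *' (unitv A - pull N (unitv B)).
  by apply/ffunP => a; rewrite !ffunE /=; ring.
by apply: cone_add; exact: cone_scale.
Qed.

Lemma valid_rel (A B : boxsys) (h : carrier A -> carrier B) (k : carrier B -> carrier A) :
  cancel h k -> cancel k h -> (forall a b, refl B (h a, h b) = refl A (a, b)) ->
  (forall f, cone f -> cone [ffun a => f (h a)]) ->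
  (forall a, unitv B (h a) = unitv A a) -> box_valid (mrel h).
Proof.
move=> hK kK e h1 h2; rewrite /box_valid (twist_rel hK kK e).
by split; exact: positive_rel.
Qed.

Lemma tcone_pull_rel (A B : boxsys) (I : finType) (h : I -> carrier A * carrier B)
    (K : {ffun I -> R} -> Prop) :
  (forall e f, K e -> K f -> K (e + f)) -> (forall c e, 0 <= c -> K e -> K (c *' e)) ->
  (forall e f, cone e -> cone f -> K [ffun a => vtens e f (h a)]) ->
  forall v, tcone (@cone A) (@cone B) v -> K [ffun a => v (h a)].
Proof.
move=> K1 K2 K3 v; elim=> [e f|{}v w _ hv _ hw|c {}v c0 _ hv]; first exact: K3.
- suff -> : [ffun a => (v + w) (h a)] = [ffun a => v (h a)] + [ffun a => w (h a)].
    exact: K1.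
  by apply/ffunP => a; rewrite !ffunE.
- suff -> : [ffun a => (c *' v) (h a)] = c *' [ffun a => v (h a)].
    exact: K2.
  by apply/ffunP => a; rewrite !ffunE.
Qed.

End Cones.
Arguments boxT R : clear implicits.
(** * The theory of boxes and hidden trits *)

Section BoxTheory.
Context {R : realType}.
Implicit Types A B C D : boxsys (R := R).

Lemma dot_pullr A B (M : {ffun carrier A * carrier B -> R}) (v : {ffun carrier A -> R}) f :
  \sum_a v a * pull M f a = \sum_b (\sum_a v a * M (a, b)) * f b.
Proof.
under eq_bigr do rewrite ffunE mulr_sumr.
rewrite exchange_big; apply: eq_bigr => b _ /=.
by rewrite mulr_suml; apply: eq_bigr => a _; rewrite mulrA.
Qed.

Lemma app_refl A (v : {ffun carrier A -> R}) :
  @app R (boxT R) A A (refl A) v = pull (refl A) v.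
Proof. by apply/ffunP => a; rewrite !ffunE; apply: eq_bigr => b _; rewrite refl_sym. Qed.

Lemma twist_prep A (v : @vec R (boxT R) A) :
  twist (A := (@box_triv R)) (B := A) (prep v) = prep (pull (refl A) v : @vec R (boxT R) A).
Proof.
rewrite /twist /= mmul1; apply/ffunP => [[t a]]; rewrite !ffunE /=.
by apply: eq_bigr => b _; rewrite ffunE /= mulrC refl_sym.
Qed.

Lemma twist_test A (e : @vec R (boxT R) A) :
  twist (A := A) (B := (@box_triv R)) (test e) = test (pull (refl A) e : @vec R (boxT R) A).
Proof.
rewrite /twist /= mmulr1; apply/ffunP => [[a t]]; rewrite !ffunE /=.
by apply: eq_bigr => b _; rewrite ffunE.
Qed.

Lemma pull_test A (e : @vec R (boxT R) A) (f : {ffun unit -> R}) :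
  pull (test e : {ffun carrier A * carrier (@box_triv R) -> R}) f = f tt *' e.
Proof.
by apply/ffunP => a; rewrite !ffunE (big_pred1 tt) => [|[]//]; rewrite ffunE mulrC.
Qed.

Lemma positive_test A (e : {ffun carrier A -> R}) :
  cone e -> cone (unitv A - e) ->
  positive_map (A := A) (B := (@box_triv R)) (test (e : @vec R (boxT R) A)).
Proof.
move=> h1 h2; split=> [f cf|]; rewrite pull_test; first by apply: cone_scale.
by rewrite ffunE scalev1.
Qed.

Lemma positive_test_inv A (e : @vec R (boxT R) A) :
  positive_map (A := A) (B := (@box_triv R)) (test e) -> cone e /\ cone (unitv A - e).
Proof.
move=> [h1 h2]; move: (h1 _ (cone_unit _)) h2; rewrite pull_test ffunE scalev1.
by [].
Qed.

Lemma valid_test A (e : @vec R (boxT R) A) :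
  cone e -> cone (unitv A - e) ->
  cone (pull (refl A) e) -> cone (unitv A - pull (refl A) e) -> is_effect e.
Proof.
by move=> h1 h2 h3 h4; split; [|rewrite twist_test]; apply: positive_test.
Qed.

Lemma pull_prep A (v : @vec R (boxT R) A) f t :
  pull (prep v : {ffun carrier (@box_triv R) * carrier A -> R}) f t = \sum_a v a * f a.
Proof. by rewrite ffunE; apply: eq_bigr => a _; rewrite ffunE. Qed.

Lemma positive_prep A (v : @vec R (boxT R) A) :
  (forall f, cone f -> 0 <= \sum_a v a * f a) -> \sum_a v a * unitv A a <= 1 ->
  positive_map (A := (@box_triv R)) (B := A) (prep v).
Proof.
move=> h1 h2; split=> [f cf|] t; first by rewrite pull_prep h1.
by rewrite ffunE [X in _ + X]ffunE pull_prep ffunE subr_ge0.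
Qed.

Lemma positive_prep_inv A (v : @vec R (boxT R) A) :
  positive_map (A := (@box_triv R)) (B := A) (prep v) ->
  (forall f, cone f -> 0 <= \sum_a v a * f a) /\ \sum_a v a * unitv A a <= 1.
Proof.
move=> [h1 h2]; split=> [f cf|]; first by have := h1 f cf tt; rewrite pull_prep.
by have := h2 tt; rewrite ffunE [X in _ + X]ffunE pull_prep ffunE subr_ge0.
Qed.

Lemma order_unit_effect A (x : {ffun carrier A -> R}) :
  exists2 N : R, 0 < N &
    is_effect (2^-1 *' unitv A + N *' x : @vec R (boxT R) A).
Proof.
have [N N0 [h1 h2]] := order_unit2 x.
have [M M0 [k1 k2]] := order_unit2 (pull (refl A) x).
have P0 : 0 < N + M by exact: addr_gt0.
have hp (y : {ffun carrier A -> R}) L L' : 0 < L -> 0 <= L' -> cone (L *' unitv A + y) ->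
    cone (2^-1 *' unitv A + (2 * (L + L'))^-1 *' y).
  move=> L0 L'0 h; have LL : L + L' != 0 by rewrite gt_eqF // ltr_wpDr.
  have -> : 2^-1 *' unitv A + (2 * (L + L'))^-1 *' y =
      (2 * (L + L'))^-1 *' ((L *' unitv A + y) + L' *' unitv A).
    by apply/ffunP => a; rewrite !ffunE; field.
  apply: cone_scale; first by rewrite invr_ge0 mulr_ge0 // addr_ge0 // ltW.
  by apply: cone_add => //; exact: cone_scale (cone_unit A).
have hm (y : {ffun carrier A -> R}) c :
    unitv A - (2^-1 *' unitv A + c *' y) = 2^-1 *' unitv A + c *' (- y).
  by apply/ffunP => a; rewrite !ffunE; field.
exists (2 * (N + M))^-1; first by rewrite invr_gt0 mulr_gt0.
have eJ : pull (refl A) (2^-1 *' unitv A + (2 * (N + M))^-1 *' x) =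
    2^-1 *' unitv A + (2 * (N + M))^-1 *' pull (refl A) x.
  by rewrite pullD !pullZ refl_unit.
apply: valid_test; rewrite ?eJ ?hm.
- exact: hp (ltW M0) h1.
- exact: hp (ltW M0) h2.
- by rewrite addrC; rewrite [N + M]addrC addrC; exact: hp (ltW N0) k1.
- by rewrite [N + M]addrC; exact: hp (ltW N0) k2.
Qed.

Lemma unit_is_effect A : @is_effect R (boxT R) A (unitv A).
Proof.
by apply: valid_test; rewrite ?refl_unit ?subrr; (exact: cone_unit || exact: cone0).
Qed.

Lemma dot_tensv A B (e : @vec R (boxT R) A) (f : @vec R (boxT R) B)
    (v : @vec R (boxT R) (box_par A B)) :
  dot (tensv e f : @vec R (boxT R) (box_par A B)) v =
  \sum_a e a * (\sum_b f b * v (a, b)).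
Proof.
rewrite /dot; under [RHS]eq_bigr do rewrite mulr_sumr.
by rewrite pair_big; apply: eq_bigr => [[a b]] _; rewrite !ffunE /= mulrA.
Qed.

(* The order unit is interior, so the effects of each system span its space. *)
Lemma effects_separate A (v w : {ffun carrier A -> R}) :
  (forall e : @vec R (boxT R) A, is_effect e -> dot e v = dot e w) -> v = w.
Proof.
move=> h; apply/ffunP => a; have [N N0 he] := order_unit_effect (basisv a).
have dl (c d : R) (e f x : {ffun carrier A -> R}) :
    @dot R (boxT R) A (c *' e + d *' f) x =
    c * @dot R (boxT R) A e x + d * @dot R (boxT R) A f x.
  rewrite /dot !mulr_sumr -big_split; apply: eq_bigr => b _.
  by rewrite !ffunE /=; ring.
have := h _ he; rewrite !dl (h _ (unit_is_effect A)) => /addrI /mulfI.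
rewrite gt_eqF // => /(_ isT); rewrite /dot.
by under eq_bigr do rewrite ffunE; under [RHS]eq_bigr do rewrite ffunE; rewrite !sum_eql.
Qed.

Lemma box_local : tomographically_local (boxT R).
Proof.
move=> A B v w _ _ h.
have hb (f : @vec R (boxT R) B) : is_effect f -> forall a,
    \sum_b f b * v (a, b) = \sum_b f b * w (a, b).
  move=> ef; have := @effects_separate A [ffun a => \sum_b f b * v (a, b)]
                      [ffun a => \sum_b f b * w (a, b)].
  move=> sep a; suff : [ffun a => \sum_b f b * v (a, b)] =
      [ffun a => \sum_b f b * w (a, b)] :> {ffun carrier A -> R}.
    by move/ffunP/(_ a); rewrite !ffunE.
  apply: sep => e ee; have := h e f ee ef; rewrite !dot_tensv /dot.
  by under [X in _ -> X = _]eq_bigr do rewrite ffunE;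
     under [X in _ -> _ = X]eq_bigr do rewrite ffunE.
apply/ffunP => [[a b]].
suff : [ffun b => v (a, b)] = [ffun b => w (a, b)] :> {ffun carrier B -> R}.
  by move/ffunP/(_ b); rewrite !ffunE.
apply: effects_separate => f ef; have := hb f ef a; rewrite /dot.
by under [X in _ -> X = _]eq_bigr do rewrite ffunE;
   under [X in _ -> _ = X]eq_bigr do rewrite ffunE.
Qed.

Lemma tcone_nonneg A B : (forall e, @cone R A e <-> nonneg e) ->
  (forall f, @cone R B f <-> nonneg f) ->
  forall v, tcone (@cone R A) (@cone R B) v <-> nonneg v.
Proof.
move=> hA hB v; split=> [|v0].
  elim=> [e f /hA e0 /hB f0 p|{}v w _ hv _ hw|c {}v c0 _ hv].
  - by rewrite ffunE mulr_ge0.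
  - exact: nonneg_add.
  - exact: nonneg_scale.
have ge0b (I : finType) (a : I) : nonneg (basisv a : {ffun I -> R}).
  by move=> b; rewrite ffunE ler0n.
rewrite [v]vtens_sum; apply: (@cone_sum _ (box_par A B)) => p; apply: tcone_prod.
  by apply/hA; apply: nonneg_scale.
exact/hB.
Qed.

Lemma classical_box A : @classical R (boxT R) A ->
  [/\ forall f, @cone R A f <-> nonneg f, unitv A = onev _ & refl A = mid _].
Proof.
elim=> [|n|B C _ [hB uB rB] _ [hC uC rC]] //; split=> /=.
- exact: tcone_nonneg.
- by apply/ffunP => p; rewrite uB uC !ffunE mulr1.
- by rewrite rB rC mtens_id.
Qed.

Lemma positive_substochastic A B (M : @trans R (boxT R) A B) :
  @classical R (boxT R) A -> @classical R (boxT R) B ->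
  positive_map (A := A) (B := B) M <-> substochastic M.
Proof.
move=> /classical_box[kA uA rA] /classical_box[kB uB rB]; rewrite /positive_map uA uB.
have sumM a : pull M (onev (carrier B)) a = \sum_b M (a, b).
  by rewrite ffunE; apply: eq_bigr => b _; rewrite ffunE mulr1.
split=> [[h1 /kA h2]|[h1 h2]].
  split=> [[a b]|a].
    have cb : @cone R B (basisv b) by apply/kB => c; rewrite ffunE ler0n.
    by have /kA/(_ a) := h1 _ cb; rewrite pull_basis.
  by have := h2 a; rewrite ffunE [X in _ + X]ffunE sumM ffunE subr_ge0.
split=> [f /kB f0|]; apply/kA => a; first by rewrite ffunE sumr_ge0 // => b _; rewrite mulr_ge0.
by rewrite ffunE [X in _ + X]ffunE sumM ffunE subr_ge0.
Qed.

Lemma valid_classical A B (M : @trans R (boxT R) A B) :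
  @classical R (boxT R) A -> @classical R (boxT R) B -> valid M <-> substochastic M.
Proof.
move=> cA cB; rewrite -(positive_substochastic M cA cB) /valid /= /box_valid /twist.
have [_ _ ->] := classical_box cA; have [_ _ ->] := classical_box cB.
by rewrite mmul1 mmulr1; split=> [[]|].
Qed.

Lemma box_gpt : is_gpt (boxT R).
Proof.
split=> //.
- by case.
- by move=> A B [].
- by move=> A; split; [exact: positive_id|rewrite twist_id; exact: positive_id].
- move=> A B C M N [M1 M2] [N1 N2]; split; first exact: positive_mul M1 N1.
  by rewrite twist_mul; exact: positive_mul M2 N2.
- move=> A B C D M N [M1 M2] [N1 N2]; split; first exact: positive_tens M1 N1.
  by rewrite twist_tens; exact: positive_tens M2 N2.
- move=> A B; apply: (@valid_rel _ (box_par A B) (box_par B A) _ (fun c => (c.2, c.1))).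
  + by case. + by case.
  + by move=> [a b] [a' b']; rewrite !ffunE /= mulrC.
  + apply: tcone_pull_rel; [exact: tcone_add|exact: tcone_scale|] => e f ce cf.
    rewrite [X in cone X](_ : _ = vtens f e); first exact: tcone_prod.
    by apply/ffunP => p; rewrite !ffunE /= mulrC.
  + by move=> [a b]; rewrite !ffunE /= mulrC.
- move=> A B C; apply: (@valid_rel _ (box_par (box_par A B) C) (box_par A (box_par B C)) _
    (fun c => ((c.1, c.2.1), c.2.2))).
  + by case=> [[]]. + by case=> a [].
  + by move=> [[a b] c] [[a' b'] c']; rewrite !ffunE /= mulrA.
  + apply: tcone_pull_rel; [exact: tcone_add|exact: tcone_scale|] => e f ce.
    elim=> [f1 f2 c1 c2|v w _ hv _ hw|c v c0 _ hv].
    * rewrite [X in cone X](_ : _ = vtens (vtens e f1) f2).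
        exact: tcone_prod (tcone_prod ce c1) c2.
      by apply/ffunP => p; rewrite !ffunE /= mulrA.
    * rewrite [X in cone X](_ : _ =
        [ffun a => vtens e v (a.1.1, (a.1.2, a.2))] + [ffun a => vtens e w (a.1.1, (a.1.2, a.2))]).
        exact: tcone_add hv hw.
      by apply/ffunP => p; rewrite !ffunE /= mulrDr.
    * rewrite [X in cone X](_ : _ = c *'
        [ffun a => vtens e v (a.1.1, (a.1.2, a.2))]).
        exact: tcone_scale c0 hv.
      by apply/ffunP => p; rewrite !ffunE /= mulrCA.
  + by move=> [[a b] c]; rewrite !ffunE /= mulrA.
- move=> A B C; apply: (@valid_rel _ (box_par A (box_par B C)) (box_par (box_par A B) C) _
    (fun c => (c.1.1, (c.1.2, c.2)))).
  + by case=> a []. + by case=> [[]].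
  + by move=> [a [b c]] [a' [b' c']]; rewrite !ffunE /= mulrA.
  + apply: tcone_pull_rel; [exact: tcone_add|exact: tcone_scale|] => e f + cf.
    elim=> [f1 f2 c1 c2|v w _ hv _ hw|c v c0 _ hv].
    * rewrite [X in cone X](_ : _ = vtens f1 (vtens f2 f)).
        exact: tcone_prod c1 (tcone_prod c2 cf).
      by apply/ffunP => p; rewrite !ffunE /= mulrA.
    * rewrite [X in cone X](_ : _ =
        [ffun a => vtens v f ((a.1, a.2.1), a.2.2)] + [ffun a => vtens w f ((a.1, a.2.1), a.2.2)]).
        exact: tcone_add hv hw.
      by apply/ffunP => p; rewrite !ffunE /= mulrDl.
    * rewrite [X in cone X](_ : _ = c *'
        [ffun a => vtens v f ((a.1, a.2.1), a.2.2)]).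
        exact: tcone_scale c0 hv.
      by apply/ffunP => p; rewrite !ffunE /= mulrA.
  + by move=> [a [b c]]; rewrite !ffunE /= mulrA.
- move=> A; apply: (@valid_rel _ (box_par (@box_triv R) A) A _ (fun a => (tt, a))).
  + by case=> [[]]. + by [].
  + by move=> [[] a] [[] b]; rewrite !ffunE /= mul1r.
  + move=> f cf; rewrite [X in cone X](_ : _ = vtens (onev unit) f).
      by apply: tcone_prod => //; exact: cone_unit.
    by apply/ffunP => p; rewrite !ffunE mul1r.
  + by move=> [t a]; rewrite !ffunE mul1r.
- move=> A; apply: (@valid_rel _ A (box_par (@box_triv R) A) _ snd).
  + by []. + by case=> [[]].
  + by move=> a b; rewrite !ffunE /= mul1r.
  + apply: tcone_pull_rel; [exact: cone_add|exact: cone_scale|] => e f ce cf.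
    rewrite [X in cone X](_ : _ = e tt *' f); first exact: cone_scale.
    by apply/ffunP => p; rewrite !ffunE.
  + by move=> a; rewrite !ffunE mul1r.
- move=> A B M N p p01 [M1 M2] [N1 N2]; split; first exact: positive_lin.
  by rewrite twist_lin; exact: positive_lin.
- move=> A v e [/positive_prep_inv[v1 v2] _] [/positive_test_inv[e1 e2] _].
  rewrite /dot; under eq_bigr do rewrite mulrC; rewrite v1 //=.
  apply: le_trans v2; rewrite -subr_ge0 -sumrB.
  have := v1 _ e2; congr (0 <= _); apply: eq_bigr => a _.
  by rewrite !ffunE mulrBr.
- by move=> A; exact: unit_is_effect.
- exact: box_local.
- split; first by move=> n; exists id.
  split; first exact: valid_classical.
  by move=> A a /classical_box[_ uA _]; rewrite /= uA ffunE.
Qed.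

End BoxTheory.
Section Symmetry.
Context {R : realType}.
Local Notation T := (boxT R).

Definition boxF (g : 'Z_2) (A : sys T) : trans A A :=
  if (g == 1)%g then idt A else refl A.

Lemma Z2_mul_eq1 (g h : 'Z_2) : (g * h == 1)%g = ((g == 1)%g == (h == 1)%g).
Proof. by case: g => [[|[|//]] ?]; case: h => [[|[|//]] ?]. Qed.

Lemma Z2_inv_eq1 (g : 'Z_2) : (g^-1 == 1)%g = (g == 1)%g.
Proof. by rewrite invg_eq1. Qed.

Lemma dot_refl (A : sys T) (e v : vec A) :
  @dot R T A (pull (refl A) e) (pull (refl A) v) = dot e v.
Proof.
rewrite /dot dot_pullr.
have -> : \sum_a e a * v a = \sum_a pull (refl A) (pull (refl A) e) a * v a.
  by rewrite -pull_mul refl_invol pull_id.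
apply: eq_bigr => a _; congr (_ * _); rewrite [RHS]ffunE.
by apply: eq_bigr => b _; rewrite refl_sym mulrC.
Qed.

Lemma app_idt (A : sys T) (v : vec A) : app (idt A) v = v.
Proof.
by apply/ffunP => a; rewrite ffunE; under eq_bigr do rewrite ffunE mulrC; rewrite sum_eqr.
Qed.

Lemma box_symmetry : is_symmetry boxF.
Proof.
split.
- by move=> A; rewrite /boxF eqxx.
- move=> g h A; rewrite /boxF Z2_mul_eq1.
  case: (g == 1%g); case: (h == 1%g) => /=.
  + by rewrite [RHS]mmul1.
  + by rewrite [RHS]mmulr1.
  + by rewrite [RHS]mmul1.
  + by rewrite [RHS]refl_invol.
- move=> g A e v; rewrite /boxF; case: ifP => _; first by rewrite !app_idt.
  by rewrite !app_refl dot_refl.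
- move=> g A B; rewrite /boxF; case: ifP => _ //.
  by rewrite [RHS]mtens_id.
- move=> g A /classical_box[_ _ rA]; rewrite /boxF; case: ifP => _ //.
- move=> g A; rewrite /boxF; case: ifP => _; first by rewrite app_idt.
  by rewrite app_refl refl_unit.
- move=> g A B M [M1 M2]; rewrite /boxF Z2_inv_eq1; case: ifP => _.
    suff -> : seqt (idt A) (seqt M (idt B)) = M by [].
    by rewrite [LHS]mmul1 [LHS]mmulr1.
  by split; rewrite ?twistK.
Qed.

(** * A hidden trit *)

Definition trit_refl : {ffun 'I_3 * 'I_3 -> R} :=
  [ffun p => 2 / 3 - (p.1 == p.2)%:R].

Lemma trit_refl_sym a b : trit_refl (a, b) = trit_refl (b, a).
Proof. by rewrite !ffunE /= eq_sym. Qed.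

Lemma ord3P (P : 'I_3 -> Prop) :
  P ord0 -> P (lift ord0 ord0) -> P ord_max -> forall a, P a.
Proof.
move=> h0 h1 h2 [[|[|[|//]]] h].
- by rewrite (_ : Ordinal h = ord0) //; exact: val_inj.
- by rewrite (_ : Ordinal h = lift ord0 ord0) //; exact: val_inj.
- by rewrite (_ : Ordinal h = ord_max) //; exact: val_inj.
Qed.

Lemma trit_refl_invol : mmul trit_refl trit_refl = mid 'I_3.
Proof.
apply/ffunP => [[a b]]; rewrite !ffunE /= !big_ord_recl big_ord0 !ffunE /=.
by move: a b; apply: ord3P; apply: ord3P; rewrite /=; field.
Qed.

Lemma trit_refl_one : pull trit_refl (onev 'I_3) = onev 'I_3.
Proof.
apply/ffunP => a; rewrite !ffunE /= !big_ord_recl big_ord0 !ffunE /=.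
by move: a; apply: ord3P; rewrite /=; field.
Qed.

Definition trit : sys T := box_simplex trit_refl_sym trit_refl_invol trit_refl_one.

Definition trit_pair : vec (par trit trit) := mid 'I_3.

Lemma pull_trit_pair : pull (refl (par trit trit)) trit_pair = trit_pair.
Proof.
apply/ffunP => [[a b]].
have -> : trit_pair (a, b) = mmul trit_refl trit_refl (a, b) by rewrite trit_refl_invol.
rewrite [LHS]ffunE [RHS]ffunE /=.
transitivity (\sum_c \sum_d trit_refl (a, c) * trit_refl (b, d) * (c == d)%:R).
  by rewrite pair_big; apply: eq_bigr => [[c d]] _; congr (_ * _); rewrite ffunE.
apply: eq_bigr => c _; rewrite [trit_refl (c, b)]trit_refl_sym.
rewrite -(sum_eql c (fun d => trit_refl (a, c) * trit_refl (b, d))).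
by apply: eq_bigr => d _; rewrite mulrC.
Qed.

Lemma trit_cone v : @cone R (par trit trit) v <-> nonneg v.
Proof. exact: tcone_nonneg. Qed.

Lemma trit_pair_state : is_state (3^-1 *' trit_pair : vec (par trit trit)).
Proof.
suff h : positive_map (A := box_triv) (B := par trit trit)
    (prep (3^-1 *' trit_pair : vec (par trit trit))).
  by split; rewrite ?twist_prep ?pullZ ?pull_trit_pair.
apply: positive_prep => [f /trit_cone f0|].
  by apply: sumr_ge0 => p _; rewrite !ffunE !mulr_ge0 ?invr_ge0.
rewrite [leLHS](_ : _ = \sum_(a : 'I_3) \sum_(b : 'I_3) (a == b)%:R * 3^-1).
  under eq_bigr do rewrite sum_eql.
  by rewrite !big_ord_recl big_ord0; lra.
by rewrite pair_big; apply: eq_bigr => [[a b]] _; rewrite !ffunE /= !mulr1 mulrC.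
Qed.

Lemma trit_pair_effect : is_effect trit_pair.
Proof.
apply: valid_test; rewrite ?pull_trit_pair; apply/trit_cone => p.
all: rewrite !ffunE /=; case: eqP => _ /=; lra.
Qed.

(* The two trits are found equal with "probability" tr(refl) / 3 = - 1/3 after
   the symmetry has been applied to one of them. *)
Lemma box_strongly_nonphysical : strongly_nonphysical boxF.
Proof.
pose g : 'Z_2 := lift ord0 ord0.
exists g, trit, (seqt (prep (3^-1 *' trit_pair : vec (par trit trit)))
                 (seqt (tens (boxF g trit) (idt trit)) (test trit_pair))); split.
  apply: generated_seq; first exact/generated_valid/trit_pair_state.
  apply: generated_seq; last exact/generated_valid/trit_pair_effect.
  apply: generated_tens; first exact: generated_new.
  by apply: generated_valid; exact: (gpt_id box_gpt).
apply/negP; rewrite negb_and -ltNge.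
suff -> : seqt (prep (3^-1 *' trit_pair : vec (par trit trit)))
   (seqt (tens (boxF g trit) (idt trit)) (test trit_pair)) (triv0, triv0) = - 3^-1.
  by rewrite oppr_lt0 invr_gt0 ltr0n.
rewrite ffunE /=.
transitivity (\sum_a \sum_b (3^-1 *' trit_pair) (a, b) *
   \sum_c \sum_d trit_refl (a, c) * (b == d)%:R * (c == d)%:R).
  rewrite pair_big; apply: eq_bigr => [[a b]] _; rewrite !ffunE /=; congr (_ * _).
  by rewrite pair_big; apply: eq_bigr => [[c d]] _; rewrite !ffunE.
under eq_bigr do under eq_bigr do under eq_bigr do
  (under eq_bigr do rewrite -mulrA mulrCA; rewrite sum_eql).
under eq_bigr do under eq_bigr do (rewrite !ffunE sum_eqr /= mulrAC -mulrA).
under eq_bigr do (rewrite -mulr_sumr; under eq_bigr do rewrite mulrC; rewrite sum_eql).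
rewrite -mulr_sumr.
by rewrite !big_ord_recl big_ord0 !ffunE /=; field.
Qed.

End Symmetry.
Lemma eq_pack (R : realType) (T : theory R) (W : eqType) (ty : W -> sys T)
    (i j : forall w, idx (ty w)) ws :
  {in ws, forall w, i w = j w} -> pack i ws = pack j ws.
Proof.
elim: ws => //= w ws IH e; rewrite (e w) ?mem_head // IH // => v v_ws.
by apply: e; rewrite inE v_ws orbT.
Qed.

(** * Erasing the symmetry from a circuit *)

Section NoGap.
Context {R : realType}.
Local Notation T := (boxT R).

Section Reindexing.
Context {W : Type} (ty ty' : W -> sys T).

Fixpoint par_map (c : forall w, carrier (ty w) -> carrier (ty' w)) (ws : seq W) :
    idx (big_par [seq ty w | w <- ws]) -> idx (big_par [seq ty' w | w <- ws]) :=
  match ws return idx (big_par [seq ty w | w <- ws]) ->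
                  idx (big_par [seq ty' w | w <- ws]) with
  | [::] => fun p => p
  | w :: ws' => fun p => (c w p.1, @par_map c ws' p.2)
  end.
Arguments par_map c ws _ : clear implicits.

Lemma par_map_pack c (i : forall w, carrier (ty w)) ws :
  par_map c ws (@pack R T W ty i ws) = @pack R T W ty' (fun w => c w (i w)) ws.
Proof. by elim: ws => //= w ws ->. Qed.

Lemma positive_par_map c ws : (forall w, positive_map (mrel (c w))) ->
  positive_map (A := big_par [seq ty w | w <- ws]) (B := big_par [seq ty' w | w <- ws])
    (mrel (par_map c ws)).
Proof.
move=> h; elim: ws => [|w ws IH] /=; first exact: positive_id.
by have := positive_tens (h w) IH; rewrite mtens_rel.
Qed.

Lemma par_map_unit c ws : (forall w a, unitv (ty' w) (c w a) = unitv (ty w) a) ->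
  forall p, unitv (big_par [seq ty' w | w <- ws]) (par_map c ws p) =
            unitv (big_par [seq ty w | w <- ws]) p.
Proof. by move=> h; elim: ws => [//|w ws IH] [a p] /=; rewrite !ffunE /= h IH. Qed.

Lemma refl_big_par ws : (forall w, refl (ty w) = mid _) ->
  refl (big_par [seq ty w | w <- ws]) = mid _.
Proof. by move=> h; elim: ws => //= w ws ->; rewrite h mtens_id. Qed.

End Reindexing.
Arguments par_map {W ty ty'} c ws _.

Lemma par_mapK W (ty ty' : W -> sys T) (c : forall w, carrier (ty w) -> carrier (ty' w))
    (d : forall w, carrier (ty' w) -> carrier (ty w)) ws :
  (forall w, cancel (c w) (d w)) -> cancel (par_map c ws) (par_map d ws).
Proof. by move=> h; elim: ws => //= w ws IH [a p] /=; rewrite h IH. Qed.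

Lemma mrel_conj (I I' J J' : finType) (f : I' -> I) (g : J -> J') (g' : J' -> J)
    (M : {ffun I * J -> R}) a b :
  cancel g g' -> cancel g' g ->
  mmul (mrel f) (mmul M (mrel g)) (a, b) = M (f a, g' b).
Proof.
move=> gK g'K; rewrite ffunE /=; under eq_bigr do rewrite ffunE /=.
rewrite sum_eql ffunE /= -(sum_eqr (g' b) (fun c => M (f a, c))).
by apply: eq_bigr => c _; rewrite ffunE /= -{1}[b]g'K (can_eq gK).
Qed.

Section UnreflCircuit.
Variables (S : causal_structure) (n : obs S -> nat) (C : @circuit R T S n).

Let Q := lgpt_sys C.
Let Q' : lgpt S -> sys T := fun l => unrefl (Q l).
Notation ty := (wire_sys n (lcls_size C) Q).
Notation ty' := (wire_sys n (lcls_size C) Q').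

Definition to_unrefl w : carrier (ty w) -> carrier (ty' w) :=
  match w with inl (inl o) => id | inl (inr l) => id | inr l => id end.
Definition of_unrefl w : carrier (ty' w) -> carrier (ty w) :=
  match w with inl (inl o) => id | inl (inr l) => id | inr l => id end.

Lemma to_unreflK w : cancel (@to_unrefl w) (@of_unrefl w).
Proof. by case: w => [[]|]. Qed.

Lemma of_unreflK w : cancel (@of_unrefl w) (@to_unrefl w).
Proof. by case: w => [[]|]. Qed.

Lemma unit_to_unrefl w a : unitv (ty' w) (@to_unrefl w a) = unitv (ty w) a.
Proof. by case: w a => [[]|]. Qed.

Lemma unit_of_unrefl w a : unitv (ty w) (@of_unrefl w a) = unitv (ty' w) a.
Proof. by case: w a => [[]|]. Qed.

Lemma positive_to_unrefl w : positive_map (mrel (@to_unrefl w)).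
Proof. by case: w => [[]|] *; exact: positive_id. Qed.

Lemma positive_of_unrefl w : positive_map (mrel (@of_unrefl w)).
Proof. by case: w => [[]|] l; apply: positive_id. Qed.

Lemma refl_unrefl w : refl (ty' w) = mid _.
Proof. by case: w => [[]|]. Qed.

Definition unrefl_op (k : gate (wiring C)) :
    trans (big_par [seq ty' w | w <- inputs k]) (big_par [seq ty' w | w <- outputs k]) :=
  mmul (mrel (par_map of_unrefl (inputs k)))
       (mmul (op k) (mrel (par_map to_unrefl (outputs k)))).

Definition unrefl_circuit : @circuit R T S n :=
  Circuit (@wiring_linear _ _ _ _ C) unrefl_op.

Lemma unrefl_opE k a b : unrefl_op k (a, b) =
  op k (par_map of_unrefl (inputs k) a, par_map of_unrefl (outputs k) b).
Proof.
by apply: mrel_conj; apply: par_mapK; [exact: to_unreflK|exact: of_unreflK].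
Qed.

Lemma deterministicP (A B : sys T) (M : trans A B) :
  deterministic M <-> pull M (unitv B) = unitv A.
Proof.
split=> [h|/ffunP h] => [|a]; first by apply/ffunP => a; rewrite ffunE h.
by rewrite -h ffunE.
Qed.

Lemma unrefl_circuit_of : circuit_of C (whole T) -> circuit_of unrefl_circuit (swirled boxF).
Proof.
move=> [_ h]; split=> // k; have [[M1 _] /deterministicP M3] := h k.
have M' : positive_map (unrefl_op k).
  apply: positive_mul; first exact/positive_par_map/positive_of_unrefl.
  by apply: positive_mul M1 _; exact/positive_par_map/positive_to_unrefl.
have rI ws : refl (big_par [seq ty' w | w <- ws]) = mid _ by exact/refl_big_par/refl_unrefl.
have FI g ws : boxF g (big_par [seq ty' w | w <- ws]) = mid _.
  by rewrite /boxF rI; case: ifP.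
split; last first.
  have uto ws : pull (mrel (par_map to_unrefl ws)) (unitv (big_par [seq ty' w | w <- ws])) =
      unitv (big_par [seq ty w | w <- ws]).
    by rewrite pull_rel; apply/ffunP => a; rewrite ffunE par_map_unit //; exact: unit_to_unrefl.
  have uof ws : pull (mrel (par_map of_unrefl ws)) (unitv (big_par [seq ty w | w <- ws])) =
      unitv (big_par [seq ty' w | w <- ws]).
    by rewrite pull_rel; apply/ffunP => a; rewrite ffunE par_map_unit //; exact: unit_of_unrefl.
  apply/deterministicP; have := uof (inputs k).
  rewrite -[X in pull _ X = _]M3 -[X in pull _ (pull _ X) = _]uto.
  by rewrite -2!pull_mul -mmulA; apply.
split=> [|g]; last first.
  by rewrite [boxF g _]FI [boxF g _]FI [LHS]mmul1 [RHS]mmulr1.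
by split=> //; rewrite /twist rI rI mmul1 mmulr1.
Qed.

Lemma unrefl_circuit_prob x : circuit_prob unrefl_circuit x = circuit_prob C x.
Proof.
pose h (i : assignment C) : assignment unrefl_circuit := finfun (fun w => to_unrefl (i w)).
pose h' (i : assignment unrefl_circuit) : assignment C := finfun (fun w => of_unrefl (i w)).
rewrite /circuit_prob (reindex h) /=; last first.
  by exists h' => i _; apply/ffunP => w; rewrite !ffunE; [exact: to_unreflK|exact: of_unreflK].
apply: eq_big => [i|i _]; first by apply: eq_forallb => o; rewrite ffunE.
apply: eq_bigr => k _; rewrite /gate_weight [LHS]unrefl_opE !par_map_pack.
by congr (op k (_, _)); apply: eq_pack => w _; rewrite ffunE to_unreflK.
Qed.

End UnreflCircuit.

Lemma box_no_gap S : ~ admits_gap S (swirled (@boxF R)) (whole T).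
Proof.
move=> [_ [n [P [[dP [C [compC validC probC]]]]]]]; apply; split=> //.
exists (unrefl_circuit C); split; [exact: compC|exact: unrefl_circuit_of|].
by move=> x; rewrite unrefl_circuit_prob.
Qed.

End NoGap.
(** * Independent sources share no frame *)

Section Frames.
Context {R : realType} {T : theory R} {G : finGroupType}.
Variable F : G -> forall A : sys T, trans A A.
Hypotheses (hT : is_gpt T) (hF : is_symmetry F).
Hypothesis commF : forall g h : G, commute g h.

Lemma sum_par (A B : sys T) (f : idx (par A B) -> R) :
  \sum_c f c = \sum_a \sum_b f (pair_idx a b).
Proof.
rewrite pair_big (reindex (fun p => pair_idx p.1 p.2)) //=.
by exists split_idx => [[a b]|c] _; rewrite ?(gpt_pairK hT) ?(gpt_splitK hT).
Qed.

Lemma tens_seqt (A B C A' B' C' : sys T) (M : trans A B) (N : trans B C)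
    (M' : trans A' B') (N' : trans B' C') :
  seqt (tens M M') (tens N N') = tens (seqt M N) (seqt M' N').
Proof.
apply/ffunP => [[a c]]; rewrite !ffunE sum_par /= mulr_suml.
apply: eq_bigr => b _; rewrite mulr_sumr; apply: eq_bigr => b' _.
by rewrite !ffunE (gpt_pairK hT) /= mulrACA.
Qed.

Lemma app_seqt (A B C : sys T) (M : trans A B) (N : trans B C) v :
  app (seqt M N) v = app N (app M v).
Proof.
apply/ffunP => c; rewrite !ffunE.
under eq_bigr do rewrite ffunE mulr_suml.
rewrite exchange_big; apply: eq_bigr => b _ /=; rewrite ffunE mulr_sumr.
by apply: eq_bigr => a _; rewrite mulrAC mulrC.
Qed.

Lemma seqt_idtr (A B : sys T) (M : trans A B) : seqt M (idt B) = M.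
Proof.
apply/ffunP => [[a b]]; rewrite ffunE /=.
by under eq_bigr do rewrite ffunE; rewrite sum_eqr.
Qed.

Lemma seqt_idtl (A B : sys T) (M : trans A B) : seqt (idt A) M = M.
Proof.
apply/ffunP => [[a b]]; rewrite ffunE /=.
by under eq_bigr do rewrite ffunE; rewrite sum_eql.
Qed.

Lemma pair_idx_eq (A B : sys T) (a : idx A) (b : idx B) (c : idx (par A B)) :
  (pair_idx a b == c) = (a == (split_idx c).1) && (b == (split_idx c).2).
Proof.
rewrite -[c in LHS](gpt_splitK hT); apply/eqP/andP => [/(congr1 split_idx)|[/eqP-> /eqP->] //].
by rewrite !(gpt_pairK hT) => [[-> ->]].
Qed.

Section PartAct.
Variables (W : finType) (ty : W -> sys T).

Lemma part_act_comm g h (D E : {set W}) ws :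
  seqt (part_act F ty g D ws) (part_act F ty h E ws) =
  seqt (part_act F ty h E ws) (part_act F ty g D ws).
Proof.
elim: ws => //= w ws IH; rewrite !tens_seqt IH; congr tens.
case: ifP => _; case: ifP => _; rewrite ?seqt_idtl ?seqt_idtr //.
by rewrite -!(sym_M hF) commF.
Qed.

Lemma part_act_notin g w0 ws (i : forall w, idx (ty w)) b : w0 \notin ws ->
  part_act F ty g [set w0] ws (pack i ws, b) = (pack i ws == b)%:R.
Proof.
elim: ws b => [|w ws IH] b /=; first by rewrite ffunE.
rewrite in_cons => /norP[]; rewrite eq_sym => /negPf ww0 w0ws.
by rewrite in_set1 ww0 ffunE (gpt_pairK hT) /= IH // ffunE /= -natrM mulnb pair_idx_eq.
Qed.

Lemma part_act_in g w0 ws (i : forall w, idx (ty w)) b : uniq ws -> w0 \in ws ->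
  part_act F ty g [set w0] ws (pack i ws, b) =
  \sum_c F g (ty w0) (i w0, c) * (pack (dfwith i c) ws == b)%:R.
Proof.
elim: ws b => [//|w ws IH] b /= /andP[wws uws]; rewrite in_cons in_set1.
have [e _|ne] := eqVneq w0 w; last first.
  rewrite /= => w0ws; rewrite ffunE (gpt_pairK hT) /= IH // mulr_sumr.
  apply: eq_bigr => c _; rewrite pair_idx_eq -mulnb natrM ffunE /= dfwith_out //; ring.
case: w / e wws b => w0ws b; rewrite ffunE (gpt_pairK hT) /= part_act_notin //.
rewrite -[LHS](sum_eqr _ (fun c => F g (ty w0) (i w0, c) * _)).
apply: eq_bigr => c _; rewrite pair_idx_eq dfwith_in -mulrA -natrM mulnb andbC.
rewrite (_ : pack (dfwith i c) ws = pack i ws) //.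
by apply: eq_pack => v vws; rewrite dfwith_out //; apply: contraNneq w0ws => ->.
Qed.

Lemma symmetrize_invariant g D ws (v : vec (big_par [seq ty w | w <- ws])) :
  app (part_act F ty g D ws) v = v ->
  app (part_act F ty g D ws) (symmetrize F v) = symmetrize F v.
Proof.
move=> inv_v; apply/ffunP => b; rewrite !ffunE.
under eq_bigr do rewrite ffunE mulrCA mulr_sumr.
rewrite -mulr_sumr; congr (_ * _); rewrite exchange_big; apply: eq_bigr => h _.
have : app (part_act F ty g D ws) (app (part_act F ty h [set: W] ws) v) b =
       app (part_act F ty h [set: W] ws) v b.
  by rewrite -app_seqt part_act_comm app_seqt inv_v.
by rewrite ffunE.
Qed.

End PartAct.

Section Averaging.
Variables (W : finType) (ty : W -> finType).

Definition dupd (i : {dffun forall w, ty w}) w (a : ty w) : {dffun forall w, ty w} :=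
  finfun (dfwith i a).

Lemma dupd_in i w (a : ty w) : dupd i a w = a.
Proof. by rewrite ffunE dfwith_in. Qed.

Lemma dupd_out i w (a : ty w) v : w != v -> dupd i a v = i v.
Proof. by move=> ne; rewrite ffunE dfwith_out. Qed.

Lemma dupd_dupd i w (a b : ty w) : dupd (dupd i a) b = dupd i b.
Proof.
apply/ffunP => v; have [e|ne] := eqVneq w v; first by case: v / e; rewrite !dupd_in.
by rewrite !dupd_out.
Qed.

Lemma dupd_id i w : dupd i (i w) = i.
Proof.
apply/ffunP => v; have [e|ne] := eqVneq w v; first by case: v / e; rewrite dupd_in.
by rewrite dupd_out.
Qed.

Lemma sum_dupd w (f : {dffun forall w, ty w} -> R) :
  \sum_i f i = \sum_i #|ty w|%:R^-1 * \sum_a f (dupd i (a : ty w)).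
Proof.
rewrite -mulr_sumr pair_big /=.
pose h (p : {dffun forall w, ty w} * ty w) := (dupd p.1 p.2, p.1 w).
have hK : involutive h.
  by move=> [i a]; rewrite /h /= dupd_dupd dupd_in dupd_id.
rewrite (reindex_inj (inv_inj hK)) /=.
rewrite -(pair_big xpredT xpredT (fun i a => f (dupd (dupd i a) (i w)))) /=.
under [X in _ * X]eq_bigr do under eq_bigr do rewrite dupd_dupd dupd_id.
rewrite mulr_sumr; apply: eq_bigr => i _.
rewrite sumr_const -[X in _ * X]mulr_natl mulrA mulVf ?mul1r // pnatr_eq0 -lt0n.
by apply/card_gt0P; exists (i w).
Qed.

End Averaging.

Section IndependentSource.
Variables (S : causal_structure) (n : obs S -> nat) (C : @circuit R T S n).
Variables (K : {set gate (wiring C)}) (l : lgpt S).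
Hypothesis swC : circuit_of C (swirled F).
Let k0 := src (wiring C) (inr l).
Hypotheses (no_input : inputs k0 = [::]) (one_output : outputs k0 = [:: inr l]).
Hypothesis lK : l \in frontier K.

Lemma covariant_source (ins outs : seq (wire S)) g c (i : assignment C)
    (M : trans (big_par [seq wsys C w | w <- ins]) (big_par [seq wsys C w | w <- outs])) :
  ins = [::] -> outs = [:: inr l] -> seqt (F g _) M = seqt M (F g _) ->
  \sum_a F g (wsys C (inr l)) (a, c) *
    M (pack (fun w => dupd i (a : idx (wsys C (inr l))) w) ins, pack (fun w => dupd i a w) outs) =
  M (pack (fun w => dupd i c w) ins, pack (fun w => dupd i c w) outs).
Proof.
move=> ei eo; subst ins outs => /=.
rewrite (sym_cls hF g (@classical_triv R T)) seqt_idtl (sym_par hF).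
rewrite (sym_cls hF g (@classical_triv R T)) => e; rewrite [in RHS]e ffunE /= sum_par.
apply: eq_bigr => a _; rewrite (sum_triv hT) [tens _ _ _]ffunE /= !(gpt_pairK hT) [idt _ _]ffunE eqxx mulr1.
by rewrite !dupd_in mulrC.
Qed.

Lemma frontier_state_invariant g :
  app (part_act F (wsys C) g [set inr l] (frontier_wires K)) (frontier_state K) =
  frontier_state K.
Proof.
have [kK dK] : k0 \in K /\ [disjoint dst (wiring C) (inr l) & K].
  by move: lK; rewrite inE => /andP[].
have uws : uniq (frontier_wires K) by rewrite map_inj_uniq ?enum_uniq // => x y [].
have lws : inr l \in frontier_wires K by rewrite map_f // mem_enum.
set ws := frontier_wires K in uws lws *.
apply/ffunP => b; rewrite [LHS]ffunE [RHS]ffunE.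
under [LHS]eq_bigr do rewrite ffunE.
set c0 := \prod_(w | _) _.
pose Wt (i : assignment C) := (\prod_(k in K) gate_weight i k) * c0.
pose pk (i : assignment C) := pack (fun w => i w) ws.
transitivity (\sum_i part_act F (wsys C) g [set inr l] ws (pk i, b) * Wt i).
  rewrite (partition_big pk xpredT) //=; apply: eq_bigr => j _; rewrite mulr_sumr.
  by apply: eq_bigr => i /eqP <-.
transitivity (\sum_i (pk i == b)%:R * Wt i); last first.
  rewrite [RHS]big_mkcond; apply: eq_bigr => i _; rewrite /pk.
  by case: eqP => _; rewrite ?mul1r ?mul0r.
rewrite (sum_dupd (inr l)) [RHS](sum_dupd (inr l)); apply: eq_bigr => i _; congr (_ * _).
pose r := (\prod_(k in K | k != k0) gate_weight i k) * c0.
have WE a : Wt (dupd i (a : idx (wsys C (inr l)))) = gate_weight (dupd i a) k0 * r.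
  rewrite /Wt (bigD1 k0) //= mulrA; congr (_ * _ * _).
  apply: eq_bigr => k /andP[kinK kk0]; rewrite /gate_weight; congr (op k (_, _)).
    apply: eq_pack => w; rewrite mem_enum inE => wk; rewrite dupd_out //.
    by apply: contraTneq wk => <-; apply: contraTN kinK => /(disjointFr dK) ->.
  apply: eq_pack => w; rewrite mem_enum inE => wk; rewrite dupd_out //.
  by apply: contraNneq kk0 => e; rewrite /k0 e eq_sym.
transitivity (\sum_c (pk (dupd i c) == b)%:R *
    \sum_a F g (wsys C (inr l)) (a, c) * Wt (dupd i a)).
  under [RHS]eq_bigr do rewrite mulr_sumr.
  rewrite exchange_big; apply: eq_bigr => a _ /=; rewrite part_act_in // mulr_suml.
  apply: eq_bigr => c _; rewrite dupd_in.
  rewrite (_ : pack _ ws = pk (dupd i c)); first by ring.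
  by apply: eq_pack => w _; rewrite -(dupd_dupd i a c) ffunE.
apply: eq_bigr => c _; congr (_ * _); rewrite WE.
under eq_bigr do rewrite WE mulrA.
rewrite -mulr_suml; congr (_ * _); rewrite /gate_weight.
apply: covariant_source => //.
by have [_ /(_ k0)[[_ /(_ g)]]] := swC.
Qed.

Lemma no_shared_frame l' : l' \in frontier K -> l' != l ->
  ~ shared_frame F (frontier_state K).
Proof.
move=> l'K ll' sf; have [||g] := sf [set inr l].
- apply/hasP; exists (inr l); last by rewrite /= inE.
  by rewrite map_f // mem_enum.
- apply/hasP; exists (inr l'); first by rewrite map_f // mem_enum.
  by rewrite /= !inE.
by apply; apply: symmetrize_invariant; exact: frontier_state_invariant.
Qed.

End IndependentSource.

Lemma full_cut_above (S : causal_structure) (n : obs S -> nat) (C : @circuit R T S n)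
    (K0 : {set gate (wiring C)}) :
  cut K0 -> exists2 K : {set gate (wiring C)}, full_cut K & frontier K0 \subset frontier K.
Proof.
move=> cK0; pose Q (K : {set gate (wiring C)}) := `[< cut K >] && (frontier K0 \subset frontier K).
have QK0 : Q K0 by rewrite /Q subxx andbT; exact/asboolP.
case: (@arg_maxnP _ K0 Q (fun K : {set gate (wiring C)} => #|frontier K|) QK0)
  => K /andP[/asboolP cK sK] maxK.
exists K => //; split=> // K' cK' sKK'; apply/eqP; rewrite eq_sym eqEcard sKK'.
by apply: maxK; rewrite /Q (subset_trans sK sKK') andbT; exact/asboolP.
Qed.

End Frames.
(** * The Bell scenario with an independent latent system *)

Definition bell_wire : finType := ((bool + bool) + void + option bool)%type.

(* Setting and outcome of party p, the system received by p from the common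
   source, and a further independent system sent to party [false]. *)
Definition setting p : bell_wire := inl (inl (inl p)).
Definition outcome p : bell_wire := inl (inl (inr p)).
Definition shared p : bell_wire := inr (Some p).
Definition extra : bell_wire := inr None.

Definition bell_gate : finType := ((bool + bool) + bool)%type.

Definition bell_src (w : bell_wire) : bell_gate :=
  match w with
  | inl (inl o) => inl o
  | inl (inr l) => match l with end
  | inr (Some _) => inr true
  | inr None => inr false
  end.

Definition bell_dst (w : bell_wire) : {set bell_gate} :=
  match w with
  | inl (inl (inl p)) => [set inl (inr p)]
  | inr (Some p) => [set inl (inr p)]
  | inr None => [set inl (inr false)]
  | _ => set0
  end.

Definition bell_shape : diagram bell_wire := Diagram bell_src bell_dst.

Lemma bell_influences v w : influences bell_shape v w ->
  exists2 p, w = outcome p & v \in [:: setting p; shared p; extra].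
Proof.
case: v => [[[p|p]|[]]|[p|]]; rewrite /influences /= ?inE //.
all: case: w => [[[q|q]|[]]|[q|]] //= /eqP[->].
- by exists p; rewrite // mem_head.
- by exists p; rewrite // !inE eqxx orbT.
- by exists false; rewrite // !inE eqxx !orbT.
Qed.

Lemma bell_acyclic : acyclic bell_shape.
Proof.
move=> v w /bell_influences[p -> vp]; apply/connectP => -[[|u s] /=].
  by move=> _ e; move: vp; rewrite e !inE.
by case/andP => /bell_influences[q _]; rewrite !inE.
Qed.

Lemma bell_linear (l : option bool) : #|dst bell_shape (inr l)| = 1%N.
Proof. by case: l => [p|]; rewrite cards1. Qed.

Definition bell : causal_structure := CausalStructure bell_acyclic bell_linear.

Definition two (o : obs bell) := 2%N.

Section BellCircuits.
Context {R : realType} {T : theory R}.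
Hypothesis hT : is_gpt T.

Section Wiring.
Context {n : obs bell -> nat}.
Variable C : @circuit R T bell n.
Hypothesis compC : compatible C.

Lemma bell_input v w : v \in inputs (src (wiring C) w) ->
  exists2 p, w = outcome p & v \in [:: setting p; shared p; extra].
Proof. by rewrite mem_enum inE => /compC.1 /bell_influences. Qed.

Lemma bell_output v w : v \in outputs (src (wiring C) w) -> bell_src v = bell_src w.
Proof. by rewrite mem_enum inE => /eqP /compC.2. Qed.

Lemma bell_inputs0 w : (forall p, w != outcome p) -> inputs (src (wiring C) w) = [::].
Proof.
move=> nw; case e : (inputs _) => [//|v s]; have : v \in v :: s by rewrite mem_head.
by rewrite -e => /bell_input[p wp]; have := nw p; rewrite wp eqxx.
Qed.

Lemma bell_outputs1 w : (forall v, bell_src v = bell_src w -> v = w) ->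
  outputs (src (wiring C) w) = [:: w].
Proof.
move=> h; rewrite -(enum1 w); apply: eq_enum => v; rewrite !inE.
by apply/eqP/eqP => [|-> //] /compC.2; exact: h.
Qed.

Lemma bell_extra_output : outputs (src (wiring C) extra) = [:: extra].
Proof. by apply: bell_outputs1; case=> [[[?|?]|[]]|[?|]]. Qed.

Lemma bell_setting_output p : outputs (src (wiring C) (setting p)) = [:: setting p].
Proof. by apply: bell_outputs1; case=> [[[q|q]|[]]|[q|]] //= [->]. Qed.

Lemma bell_outcome_output p : outputs (src (wiring C) (outcome p)) = [:: outcome p].
Proof. by apply: bell_outputs1; case=> [[[q|q]|[]]|[q|]] //= [->]. Qed.

End Wiring.

Lemma bell_no_frame (G : finGroupType) (F : G -> forall A : sys T, trans A A) :
  is_symmetry F -> (forall g h : G, commute g h) -> ~ allows_shared_frame F bell.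
Proof.
move=> hF commF [n [C [compC validC frameC]]].
pose K0 := [set src (wiring C) extra; src (wiring C) (shared true)].
have noin w k : k \in K0 -> k \in dst (wiring C) w -> False.
  rewrite !inE => /orP[]/eqP-> wk.
  - have : w \in inputs (src (wiring C) extra) by rewrite mem_enum inE.
    by case/(bell_input compC).
  - have : w \in inputs (src (wiring C) (shared true)) by rewrite mem_enum inE.
    by case/(bell_input compC).
have cK0 : cut K0 by move=> w k kK /(noin _ _ kK).
have fK0 (l : lgpt bell) : src (wiring C) (inr l) \in K0 -> l \in frontier K0.
  move=> lK; rewrite inE lK /= disjoint_sym; apply/pred0P => k /=.
  by apply/negP => /andP[/noin h /h].
have [K fK /subsetP sK] := full_cut_above cK0.
have lK : None \in frontier K by apply/sK/fK0; rewrite !inE eqxx.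
have lK' : Some true \in frontier K by apply/sK/fK0; rewrite !inE eqxx orbT.
have := frameC K fK; apply: (no_shared_frame hT hF commF validC _ _ lK lK') => //.
  exact: bell_inputs0.
exact: bell_extra_output.
Qed.

(** * Classical circuits cannot produce a PR box *)

Definition bit (a : 'I_2) : bool := a == ord_max.

Definition pr_rule (x : {dffun forall o : obs bell, 'I_(two o)}) :=
  bit (x (inr true)) (+) bit (x (inr false)) == bit (x (inl true)) && bit (x (inl false)).

Lemma big_par0 (W : Type) (ty : W -> sys T) (i : forall w, idx (ty w)) ws :
  ws = [::] -> forall b, b = pack i ws.
Proof. by move=> -> b; rewrite /= (gpt_triv hT b). Qed.

Lemma big_par1 (W : eqType) (ty : W -> sys T) w ws :
  ws = [:: w] -> forall b : idx (big_par [seq ty w | w <- ws]),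
  exists d : idx (ty w), forall i : (forall w, idx (ty w)), i w = d -> pack i ws = b.
Proof.
move=> -> b; exists (split_idx b).1 => i /= ->.
by rewrite -[RHS](gpt_splitK hT) (gpt_triv hT (split_idx b).2).
Qed.

Section Classical.
Variable C : @circuit R T bell two.
Hypotheses (compC : compatible C) (cptC : circuit_of C (cpt T)).

Lemma op_ge0 k p : 0 <= op (c := C) k p.
Proof.
have [_ /(_ k)[[cA cB vM] _]] := cptC.
have [_ [cptV _]] := gpt_cpt hT.
by have [ge0 _] := (cptV _ _ _ cA cB).1 vM; exact: ge0.
Qed.

Lemma op_sum1 k a : \sum_b op (c := C) k (a, b) = 1.
Proof.
have [_ /(_ k)[[cA cB vM] det]] := cptC; have [_ [_ u1]] := gpt_cpt hT.
have := det a; rewrite u1 // => <-; apply: eq_bigr => b _.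
by rewrite u1 // mulr1.
Qed.

Lemma weight_ge0 (i : assignment C) k : 0 <= gate_weight i k.
Proof. exact: op_ge0. Qed.

Lemma weight_gt0 (i : assignment C) k : (0 < gate_weight i k) = (gate_weight i k != 0).
Proof. by rewrite lt0r weight_ge0 andbT. Qed.

Lemma circuit_prob_support (x : {dffun forall o : obs bell, 'I_(two o)}) : circuit_prob C x != 0 ->
  exists2 i : assignment C, (forall o, cls_val (i (inl (inl o))) = x o) &
    forall k, gate_weight i k != 0.
Proof.
move=> nz; apply: contrapT => no; move/eqP: nz; apply.
rewrite /circuit_prob big1 // => i /forallP ix; apply/eqP; rewrite prodf_seq_eq0.
apply/hasP; apply: contrapT => no'; apply: no; exists i => [o|k]; first exact/eqP.
by apply/negP => k0; apply: no'; exists k; rewrite ?mem_index_enum.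
Qed.

Lemma circuit_prob_neq0 (x : {dffun forall o : obs bell, 'I_(two o)}) (i : assignment C) :
  (forall o, cls_val (i (inl (inl o))) = x o) -> (forall k, gate_weight i k != 0) ->
  circuit_prob C x != 0.
Proof.
move=> ix ik; rewrite /circuit_prob (bigD1 i) /=; last by apply/forallP => o; rewrite ix.
rewrite gt_eqF // ltr_pwDl //; last first.
  by apply: sumr_ge0 => j _; apply: prodr_ge0 => k _; exact: weight_ge0.
by apply: prodr_gt0 => k _; rewrite weight_gt0.
Qed.

Definition with_obs (i : assignment C) (v : obs bell -> idx (@cls R T 2)) : assignment C :=
  finfun (fun w : wire bell => match w return idx (wsys C w) with
          | inl (inl o) => v o
          | inl (inr l) => i (inl (inr l))
          | inr l => i (inr l)
          end).

(* The possibilistic Bell argument: once the latent values of one possible run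
   are fixed, all the responses to all the settings are possible together. *)
Lemma classical_not_pr : ~ (forall x, (circuit_prob C x != 0) = pr_rule x).
Proof.
move=> pr.
have ex (p : bool) (s : 'I_2) : exists2 i : assignment C,
    cls_val (i (setting p)) = s & forall k, gate_weight i k != 0.
  pose x : {dffun forall o : obs bell, 'I_(two o)} :=
    [ffun o => if o == inl p then s else ord0].
  have /circuit_prob_support[i ix ik] : circuit_prob C x != 0.
    rewrite pr /pr_rule !ffunE /=.
    by case: p {x}; rewrite /= ?andbF.
  by exists i => //; rewrite ix ffunE eqxx.
have [i0 _ i0k] := ex true ord0.
pose latents (i : assignment C) := forall l : option bool, i (inr l) = i0 (inr l).
have resp (ps : bool * 'I_2) : exists cd : idx (@cls R T 2) * idx (@cls R T 2),
    cls_val cd.1 = ps.2 /\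
    forall i : assignment C, i (setting ps.1) = cd.1 ->
      gate_weight i (src (wiring C) (setting ps.1)) != 0 /\
      (latents i -> i (outcome ps.1) = cd.2 ->
       gate_weight i (src (wiring C) (outcome ps.1)) != 0).
  case: ps => p s /=; have [i1 i1s i1k] := ex p s.
  pose ins := inputs (src (wiring C) (outcome p)).
  pose i2 := with_obs i0 (fun _ => i1 (setting p)).
  have [b b0] : exists b, op (c := C) (src (wiring C) (outcome p))
                            (pack (fun w => i2 w) ins, b) != 0.
    apply: contrapT => no.
      have := op_sum1 (k := src (wiring C) (outcome p)) (pack (fun w => i2 w) ins).
    rewrite big1 => [/esym/eqP|b _]; first by rewrite oner_eq0.
    by apply/eqP; apply: contrapT => /negP nz; apply: no; exists b.
  have [d db] := @big_par1 _ (wsys C) _ _ (bell_outcome_output compC p) b.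
  exists (i1 (setting p), d); split=> //= i ip; split=> [|li id].
    have := i1k (src (wiring C) (setting p)); rewrite /gate_weight.
    rewrite (_ : (pack _ _, pack _ _) =
      (pack (fun w => i w) (inputs _), pack (fun w => i w) (outputs _))) //.
    congr pair; apply: eq_pack => w.
      by rewrite (bell_inputs0 compC).
    by rewrite (bell_setting_output compC) inE => /eqP->.
  rewrite /gate_weight (db (fun w => i w)) //.
  rewrite (_ : pack _ _ = pack (fun w => i2 w) ins) //.
  apply: eq_pack => w /(bell_input compC)[q [<-]].
  by rewrite !inE => /or3P[]/eqP->; rewrite ffunE //=; apply: li.
have [f fP] := choice resp.
have rule (s : bool -> 'I_2) : bit (cls_val (f (true, s true)).2) (+)
    bit (cls_val (f (false, s false)).2) = bit (s true) && bit (s false).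
  pose i := with_obs i0 (fun o => match o with
              inl p => (f (p, s p)).1 | inr p => (f (p, s p)).2 end).
  pose x : {dffun forall o : obs bell, 'I_(two o)} :=
    [ffun o => cls_val (i (inl (inl o)) : idx (cls 2))].
  have : circuit_prob C x != 0.
    apply: (circuit_prob_neq0 (i := i)) => [o|k]; first by rewrite [RHS]ffunE.
    case e : (outputs k) => [|w ws].
      have := op_sum1 (k := k) (pack (fun w => i w) (inputs k)).
      rewrite (bigD1 (pack (fun w => i w) (outputs k))) //= big1 ?addr0 => [|b].
        by rewrite /gate_weight => ->; exact: oner_neq0.
      by rewrite (big_par0 (fun w => i w) e b) eqxx.
    have kw : src (wiring C) w = k.
      by have : w \in outputs k by [rewrite e mem_head]; rewrite mem_enum inE => /eqP.
    have {e} : forall v, v \in outputs k -> bell_src v = bell_src w.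
      by rewrite -kw => v /(bell_output compC).
    case: w kw => [[[p|p]|[]]|l] <- out.
    + have [_ h] := fP (p, s p); have is_p : i (setting p) = (f (p, s p)).1 by rewrite ffunE.
      by have [] := h i is_p.
    + have [_ h] := fP (p, s p); have is_p : i (setting p) = (f (p, s p)).1 by rewrite ffunE.
      by have [_] := h i is_p; apply => [l|]; rewrite ffunE.
    + have := i0k (src (wiring C) (inr l)); rewrite /gate_weight.
      rewrite (_ : (pack _ _, pack _ _) =
      (pack (fun w => i w) (inputs _), pack (fun w => i w) (outputs _))) //.
      congr pair; apply: eq_pack => w; first by rewrite (bell_inputs0 compC).
      move=> /out; case: w => [[[q|q]|[]]|l'] /=; first [by case: l {out}|by rewrite ffunE].
  by rewrite pr /pr_rule !ffunE => /eqP->; rewrite !(fP _).1.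
have := rule (fun _ => ord0); have := rule (fun _ => ord_max).
have := rule (fun p => if p then ord0 else ord_max).
have := rule (fun p => if p then ord_max else ord0).
rewrite /=; do 4 case: (bit (cls_val _)) => //.
Qed.

End Classical.

End BellCircuits.
Section PRBox.
Context {R : realType}.
Local Notation T := (boxT R).

(* Coordinates of a state: the probabilities of outcome 0 for the two
   measurements, and the norm. *)
Definition gbit_effect (x a : 'I_2) : {ffun 'I_3 -> R} :=
  [ffun j : 'I_3 => if bit a then (val j == 2)%:R - (val j == val x)%:R
                    else (val j == val x)%:R].

Definition gbit_unit : {ffun 'I_3 -> R} := [ffun j : 'I_3 => (val j == 2)%:R].

Inductive gbit_cone : {ffun 'I_3 -> R} -> Prop :=
| gbit_effect_in x a : gbit_cone (gbit_effect x a)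
| gbit_add e f : gbit_cone e -> gbit_cone f -> gbit_cone (e + f)
| gbit_scale c e : 0 <= c -> gbit_cone e -> gbit_cone (c *' e).

Lemma gbit_effectD x : gbit_effect x ord0 + gbit_effect x ord_max = gbit_unit.
Proof. by apply/ffunP => j; rewrite !ffunE /bit eqxx /= addrC subrK. Qed.

Lemma gbit_unit_in : gbit_cone gbit_unit.
Proof. by rewrite -(gbit_effectD ord0); apply: gbit_add; exact: gbit_effect_in. Qed.

Lemma gbit_order_unit : order_unit gbit_cone gbit_unit.
Proof.
have hn (x : R) : 0 <= `|x| + x by have := ler_norm (- x); rewrite normrN; lra.
move=> v; set n := fun j => `|v j|.
exists (1 + n ord0 + n (lift ord0 ord0) + n ord_max).
  by rewrite /n -!addrA ltr_pwDl // !addr_ge0.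
pose A (x : 'I_2) (y : R) : {ffun 'I_3 -> R} :=
  (`|y| + y) *' gbit_effect x ord0 + `|y| *' gbit_effect x ord_max.
have AK x y : gbit_cone (A x y).
  by apply: gbit_add; apply: gbit_scale => //; exact: gbit_effect_in.
have -> : (1 + n ord0 + n (lift ord0 ord0) + n ord_max) *' gbit_unit + v =
    gbit_unit + A ord0 (v ord0) + A ord_max (v (lift ord0 ord0)) +
    (n ord_max + v ord_max) *' gbit_unit.
  apply/ffunP; apply: ord3P; rewrite /n !ffunE /bit /=; ring.
apply: gbit_add; last by apply: gbit_scale; [exact: hn|exact: gbit_unit_in].
by apply: gbit_add => //; apply: gbit_add => //; exact: gbit_unit_in.
Qed.

Definition gbit : sys T :=
  Boxsys gbit_add gbit_scale gbit_unit_in gbit_order_unit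
    (@mid_sym R 'I_3) (mmul1 _) (pull_id _).

Definition pr_state (i j : 'I_3) : R :=
  match val i, val j with
  | 2, 2 => 1
  | 2, _ | _, 2 => 2^-1
  | 1, 1 => 0
  | _, _ => 2^-1
  end.

Lemma ord2P (P : 'I_2 -> Prop) : P ord0 -> P ord_max -> forall a, P a.
Proof.
move=> h0 h1 [[|[|//]] h].
- by rewrite (_ : Ordinal h = ord0) //; exact: val_inj.
- by rewrite (_ : Ordinal h = ord_max) //; exact: val_inj.
Qed.

Lemma pr_stateE x y a b :
  \sum_i \sum_j pr_state i j * (gbit_effect x a i * gbit_effect y b j) =
  if bit a (+) bit b == bit x && bit y then 2^-1 else 0.
Proof.
rewrite !big_ord_recl !big_ord0 !ffunE /pr_state /=.
by move: x y a b; do 4 apply: ord2P; rewrite /bit /=; field.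
Qed.

Lemma pr_state_ge0 e f : gbit_cone e -> gbit_cone f ->
  0 <= \sum_i \sum_j pr_state i j * (e i * f j).
Proof.
elim=> [x a|e1 e2 _ h1 _ h2|c e1 c0 _ h1] cf.
- elim: cf => [y b|f1 f2 _ h1 _ h2|c f1 c0 _ h1].
  + by rewrite pr_stateE; case: ifP => _; rewrite ?invr_ge0 ?ler0n.
  + have := addr_ge0 h1 h2; rewrite -big_split; congr (0 <= _); apply: eq_bigr => i _.
    by rewrite -big_split; apply: eq_bigr => j _; rewrite !ffunE /=; ring.
  + have := mulr_ge0 c0 h1; rewrite mulr_sumr; congr (0 <= _); apply: eq_bigr => i _.
    by rewrite mulr_sumr; apply: eq_bigr => j _; rewrite !ffunE /=; ring.
- have := addr_ge0 (h1 cf) (h2 cf); rewrite -big_split; congr (0 <= _); apply: eq_bigr => i _.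
  by rewrite -big_split; apply: eq_bigr => j _; rewrite !ffunE /=; ring.
- have := mulr_ge0 c0 (h1 cf); rewrite mulr_sumr; congr (0 <= _); apply: eq_bigr => i _.
  by rewrite mulr_sumr; apply: eq_bigr => j _; rewrite !ffunE /=; ring.
Qed.

(** * The circuit producing the PR box *)

Definition pr_ins (k : bell_gate) : seq bell_wire :=
  match k with
  | inl (inr true) => [:: setting true; shared true]
  | inl (inr false) => [:: setting false; extra; shared false]
  | _ => [::]
  end.

Definition pr_outs (k : bell_gate) : seq bell_wire :=
  match k with
  | inl o => [:: inl (inl o)]
  | inr true => [:: shared true; shared false]
  | inr false => [:: extra]
  end.

Lemma enum_bell_wire : Finite.enum bell_wire =
  [:: setting true; setting false; outcome true; outcome false;
      extra; shared true; shared false].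
Proof. by do 4 rewrite ?unlock /= ?/sum_enum /=. Qed.

Lemma pr_insE (k : bell_gate) : pr_ins k = inputs (D := bell_shape) k.
Proof.
rewrite /inputs /enum_mem enum_bell_wire.
by case: k => [[[]|[]]|[]]; rewrite /= !inE.
Qed.

Lemma pr_outsE (k : bell_gate) : pr_outs k = outputs (D := bell_shape) k.
Proof.
rewrite /outputs /enum_mem enum_bell_wire.
by case: k => [[[]|[]]|[]].
Qed.

Definition pr_sys (l : lgpt bell) : sys T := if l is Some _ then gbit else triv.

Notation ty := (wire_sys two (fun _ => 0%N) pr_sys).

Lemma valid_unreflected (A B : sys T) (M : trans A B) :
  refl A = mid _ -> refl B = mid _ -> positive_map M -> box_valid M.
Proof. by move=> rA rB h; split; rewrite // /twist rA rB mmul1 mmulr1. Qed.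

Definition controlled_test (A : sys T) (h : 'I_2 -> 'I_2 -> {ffun carrier A -> R}) :
    trans (par (cls 2) A) (par (cls 2) triv) :=
  [ffun q => h q.1.1 q.2.1 q.1.2].

Lemma controlled_testP (A : sys T) (h : 'I_2 -> 'I_2 -> {ffun carrier A -> R}) :
  refl A = mid _ -> (forall x a, cone (h x a)) ->
  (forall x, h x ord0 + h x ord_max = unitv A) ->
  valid (controlled_test h) /\ deterministic (controlled_test h).
Proof.
move=> rA hc h1.
have pullE f x v : pull (controlled_test h) f (x, v) = \sum_a h x a v * f (a, tt).
  rewrite ffunE.
  transitivity (\sum_a \sum_(t : unit) controlled_test h ((x, v), (a, t)) * f (a, t)).
    by rewrite pair_big; apply: eq_bigr => [[a t]] _.
  by apply: eq_bigr => a _; rewrite (big_pred1 tt) => [|[]//]; rewrite ffunE.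
have det : pull (controlled_test h) (unitv (par (cls 2) triv : sys T)) =
      unitv (par (cls 2) A : sys T).
  apply/ffunP => [[x v]]; rewrite pullE [RHS]ffunE /= ffunE mul1r -(h1 x).
  by rewrite !big_ord_recl big_ord0 !ffunE !mulr1 addr0 (_ : lift _ _ = ord_max) //; exact: val_inj.
split; last exact/deterministicP.
apply: valid_unreflected => /=; rewrite ?rA ?mtens_id //.
split=> [f|]; last by rewrite [X in _ - X]det subrr; exact: cone0.
have cP (I : finType) e : @cone R (box_cls_on I) e <-> nonneg e by [].
move=> /(@tcone_nonneg R (box_cls 2) box_triv (@cP _) (@cP _)) f0.
have -> : pull (controlled_test h) f =
    \sum_x \sum_a vtens (f (a, tt) *' basisv x) (h x a).
  apply/ffunP => [[x v]]; rewrite pullE sum_ffunE.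
  under [RHS]eq_bigr do rewrite sum_ffunE.
  rewrite exchange_big; apply: eq_bigr => a _ /=.
  rewrite -(sum_eqr x (fun y => h y a v * f (a, tt))); apply: eq_bigr => y _.
  by rewrite !ffunE /=; ring.
apply: (@cone_sum R (par (cls 2) A)) => x; apply: (@cone_sum R (par (cls 2) A)) => a.
apply: tcone_prod => // y; rewrite !ffunE; apply: mulr_ge0 => //; exact: f0.
Qed.

Definition pr_op (k : bell_gate) :
    trans (big_par [seq ty w | w <- pr_ins k]) (big_par [seq ty w | w <- pr_outs k]) :=
  match k with
  | inl (inl p) => [ffun _ => 2^-1]
  | inl (inr true) =>
      controlled_test (A := par gbit triv) (fun x a => [ffun q => gbit_effect x a q.1])
  | inl (inr false) =>
      controlled_test (A := par triv (par gbit triv))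
        (fun x a => [ffun q => gbit_effect x a q.2.1])
  | inr true => [ffun q => pr_state q.2.1 q.2.2.1]
  | inr false => [ffun _ => 1]
  end.

Lemma pr_refl ws : refl (big_par [seq ty w | w <- ws]) = mid _.
Proof. by apply: refl_big_par => -[[o|[]]|[p|]]. Qed.

Lemma pr_state_preparation :
  valid (pr_op (inr true)) /\ deterministic (pr_op (inr true)).
Proof.
have sumE (f : {ffun 'I_3 * ('I_3 * unit) -> R}) :
    \sum_q pr_op (inr true) (triv0, q) * f q =
      \sum_(i : 'I_3) \sum_(j : 'I_3) pr_state i j * f (i, (j, tt)).
  transitivity (\sum_i \sum_j \sum_(t : unit) pr_state i j * f (i, (j, t))).
    under [RHS]eq_bigr do rewrite pair_big.
    by rewrite pair_big; apply: eq_bigr => [[i [j t]]] _; rewrite ffunE.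
  by apply: eq_bigr => i _; apply: eq_bigr => j _; rewrite (big_pred1 tt) // => -[].
have norm : \sum_q pr_op (inr true) (triv0, q) * unitv (par gbit (par gbit triv)) q = 1.
  rewrite sumE !big_ord_recl !big_ord0 !ffunE /pr_state /=.
  by field.
split; last by case; rewrite norm ffunE.
apply: valid_unreflected; rewrite ?pr_refl //.
have eP : pr_op (inr true) = prep ([ffun q => pr_state q.1 q.2.1] : vec (par gbit (par gbit triv))).
  by apply/ffunP => q; rewrite !ffunE.
rewrite eP; apply: positive_prep => [f|]; last first.
  by rewrite -[leRHS]norm eP le_eqVlt; apply/orP; left; apply/eqP/eq_bigr => q _; rewrite !ffunE.
move=> cf; suff : 0 <=
      \sum_(i : 'I_3) \sum_(j : 'I_3) pr_state i j * f (i, (j, tt)).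
  by rewrite -sumE eP; congr (0 <= _); apply: eq_bigr => q _; rewrite !ffunE.
elim: cf => [e g ce|g1 g2 _ h1 _ h2|c g c0 _ h].
- elim=> [g1 t cg ct|g1 g2 _ h1 _ h2|c g' c0 _ h].
  + have := mulr_ge0 (ct tt) (pr_state_ge0 ce cg); rewrite mulr_sumr; congr (0 <= _).
    apply: eq_bigr => i _; rewrite mulr_sumr; apply: eq_bigr => j _.
    by rewrite !ffunE /=; ring.
  + have := addr_ge0 h1 h2; rewrite -big_split; congr (0 <= _); apply: eq_bigr => i _.
    by rewrite -big_split; apply: eq_bigr => j _; rewrite !ffunE /=; ring.
  + have := mulr_ge0 c0 h; rewrite mulr_sumr; congr (0 <= _); apply: eq_bigr => i _.
    by rewrite mulr_sumr; apply: eq_bigr => j _; rewrite !ffunE /=; ring.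
- have := addr_ge0 h1 h2; rewrite -big_split; congr (0 <= _); apply: eq_bigr => i _.
  by rewrite -big_split; apply: eq_bigr => j _; rewrite !ffunE /=; ring.
- have := mulr_ge0 c0 h; rewrite mulr_sumr; congr (0 <= _); apply: eq_bigr => i _.
  by rewrite mulr_sumr; apply: eq_bigr => j _; rewrite !ffunE /=; ring.
Qed.

Lemma classical_source (A : sys T) (M : trans triv A) :
  classical A -> (forall p, 0 <= M p) -> (forall a, \sum_b M (a, b) = 1) ->
  valid M /\ deterministic M.
Proof.
move=> cA M0 M1; split.
  by apply/valid_classical => //; [exact: classical_triv|split=> // a; rewrite M1].
move=> a; rewrite [RHS]ffunE -(M1 a); apply: eq_bigr => b _.
by have [_ uA _] := classical_box cA; rewrite /= uA ffunE mulr1.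
Qed.

Lemma pr_op_valid k : valid (pr_op k) /\ deterministic (pr_op k).
Proof.
have sumu (I : finType) (f : I * unit -> R) : \sum_q f q = \sum_i f (i, tt).
  transitivity (\sum_i \sum_(t : unit) f (i, t)).
    by rewrite pair_big; apply: eq_bigr => [[i t]] _.
  by apply: eq_bigr => i _; rewrite (big_pred1 tt) // => -[].
case: k => [[p|[]]|[]].
- apply: classical_source => [|q|a].
  + by apply: classical_par; [exact: classical_cls|exact: classical_triv].
  + by rewrite ffunE invr_ge0.
  + by rewrite sumu !big_ord_recl big_ord0 !ffunE; field.
- apply: controlled_testP => [|x a|x]; first by rewrite /= mtens_id.
  + rewrite (_ : [ffun q => _] = vtens (gbit_effect x a) (onev unit)).
      by apply: tcone_prod; [exact: gbit_effect_in|exact: nonneg_one].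
    by apply/ffunP => q; rewrite !ffunE mulr1.
  + by apply/ffunP => q; rewrite [RHS]ffunE /= -(gbit_effectD x) !ffunE mulr1.
- apply: controlled_testP => [|x a|x]; first by rewrite /= !mtens_id.
  + rewrite (_ : [ffun q => _] = vtens (onev unit) (vtens (gbit_effect x a) (onev unit))).
      by do 2 ?[apply: tcone_prod]; [exact: nonneg_one|exact: gbit_effect_in|exact: nonneg_one].
    by apply/ffunP => q; rewrite !ffunE mul1r mulr1.
  + apply/ffunP => q; rewrite [RHS]ffunE /= [X in X * _]ffunE mul1r [RHS]ffunE /=.
    by rewrite -(gbit_effectD x) !ffunE mulr1.
- exact: pr_state_preparation.
- apply: classical_source => [|q|a].
  + by apply: classical_par; exact: classical_triv.
  + by rewrite ffunE.
  + by rewrite sumu (big_pred1 tt) => [|[]//]; rewrite ffunE.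
Qed.

Definition cast_op (i1 i2 o1 o2 : seq bell_wire) (ei : i1 = i2) (eo : o1 = o2)
    (M : trans (big_par [seq ty w | w <- i1]) (big_par [seq ty w | w <- o1])) :
    trans (big_par [seq ty w | w <- i2]) (big_par [seq ty w | w <- o2]) :=
  match ei in _ = i, eo in _ = o
    return trans (big_par [seq ty w | w <- i]) (big_par [seq ty w | w <- o]) with
  | erefl, erefl => M
  end.

Definition pr_circuit : @circuit R T bell two :=
  @Circuit R T bell two (fun _ => 0%N) pr_sys bell_shape bell_linear
    (fun k => cast_op (pr_insE k) (pr_outsE k) (pr_op k)).

Lemma cast_op_valid i1 i2 o1 o2 (ei : i1 = i2) (eo : o1 = o2) M :
  valid M /\ deterministic M -> valid (cast_op ei eo M) /\ deterministic (cast_op ei eo M).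
Proof. by case: i2 / ei; case: o2 / eo. Qed.

Lemma cast_op_pack i1 i2 o1 o2 (ei : i1 = i2) (eo : o1 = o2) M (i : forall w, idx (ty w)) :
  cast_op ei eo M (pack i i2, pack i o2) = M (pack i i1, pack i o1).
Proof. by case: i2 / ei; case: o2 / eo. Qed.

Lemma pr_circuit_of : circuit_of pr_circuit (whole T).
Proof. by split=> // k; apply: cast_op_valid; exact: pr_op_valid. Qed.

Lemma pr_circuit_compatible : compatible pr_circuit.
Proof. by []. Qed.

Lemma pr_circuit_prob x : circuit_prob pr_circuit x = if pr_rule x then 8^-1 else 0.
Proof.
pose h (q : 'I_3 * 'I_3) : assignment pr_circuit :=
  finfun (fun w : bell_wire => match w return idx (ty w) with
    | inl (inl o) => x o
    | inl (inr l) => match l with end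
    | inr (Some true) => q.1
    | inr (Some false) => q.2
    | inr None => tt
    end).
pose h' (i : assignment pr_circuit) : 'I_3 * 'I_3 := (i (shared true), i (shared false)).
rewrite /circuit_prob (reindex_onto h h') /=; last first.
  move=> i /forallP ix; apply/ffunP => -[[o|[]]|[[]|]]; rewrite ffunE //=.
    by rewrite -(eqP (ix o)).
  by case: (i _).
transitivity (\sum_(q : 'I_3 * 'I_3) 4^-1 * (pr_state q.1 q.2 *
   (gbit_effect (x (inl true)) (x (inr true)) q.1 *
    gbit_effect (x (inl false)) (x (inr false)) q.2))).
  apply: eq_big => [q|q _].
    apply/andP; split; last by rewrite /h' !ffunE /=; case: q.
    by apply/forallP => o; rewrite ffunE.
  have wE k : gate_weight (h q) k =
      pr_op k (pack (fun w => h q w) (pr_ins k), pack (fun w => h q w) (pr_outs k)).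
    exact: cast_op_pack.
  rewrite (eq_bigr _ (fun k _ => wE k)) !big_sumType /= !big_bool /= !ffunE /=.
  by field.
rewrite -mulr_sumr -(pair_bigA _ (fun i j => pr_state i j *
   (gbit_effect (x (inl true)) (x (inr true)) i *
    gbit_effect (x (inl false)) (x (inr false)) j))) /= pr_stateE /pr_rule.
by case: ifP => _; field.
Qed.

Definition pr_dist (x : {dffun forall o : obs bell, 'I_(two o)}) : R :=
  if pr_rule x then 8^-1 else 0.

Lemma pr_dist_distribution : is_distribution pr_dist.
Proof.
split=> [x|]; first by rewrite /pr_dist; case: ifP; rewrite ?invr_ge0.
pose h (q : ('I_2 * 'I_2) * ('I_2 * 'I_2)) : {dffun forall o : obs bell, 'I_(two o)} :=
  finfun (fun o : obs bell => match o with
     | inl true => q.1.1 | inl false => q.1.2 | inr true => q.2.1 | inr false => q.2.2 end).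
rewrite (reindex h) /=; last first.
  exists (fun x : {dffun forall o : obs bell, 'I_(two o)} =>
           ((x (inl true), x (inl false)), (x (inr true), x (inr false)))) => [[[a b] [c d]]|x] _.
    by rewrite !ffunE.
  by apply/ffunP => -[[]|[]]; rewrite ffunE.
transitivity (\sum_x \sum_y \sum_a \sum_b
    (if bit a (+) bit b == bit x && bit y then 8^-1 else 0 : R)).
  rewrite pair_big; under [RHS]eq_bigr do rewrite pair_big.
  by rewrite pair_big; apply: eq_bigr => [[[x y] [a b]]] _; rewrite /pr_dist /pr_rule !ffunE.
by rewrite !big_ord_recl !big_ord0 /bit /=; field.
Qed.

Lemma pr_gap : admits_gap bell (cpt T) (whole T).
Proof.
split=> [n P [dP [C [compC [_ opC] probC]]]|].
  split=> //; exists C; split=> //; split=> // k.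
  by have [[_ _ vk] dk] := opC k.
exists two, pr_dist; split.
  split; first exact: pr_dist_distribution.
  exists pr_circuit; split; [exact: pr_circuit_compatible|exact: pr_circuit_of|].
  exact: pr_circuit_prob.
move=> [_ [C [compC cptC probC]]]; apply: (classical_not_pr box_gpt compC cptC) => x.
by rewrite probC /pr_dist; case: ifP => _; rewrite ?eqxx ?invr_eq0 ?pnatr_eq0.
Qed.

End PRBox.

Theorem corollary4 (R : realType) :
  ~ (forall (T : theory R) (G : finGroupType)
            (F : G -> forall A : sys T, trans A A) (S : causal_structure),
       is_gpt T ->
       is_symmetry F ->
       strongly_nonphysical F ->
       admits_gap S (cpt T) (whole T) ->
       ~ allows_shared_frame F S ->
       admits_gap S (swirled F) (whole T)).
Proof.
move=> h; apply: (@box_no_gap R bell); apply: h.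
- exact: box_gpt.
- exact: box_symmetry.
- exact: box_strongly_nonphysical.
- exact: pr_gap.
- apply: bell_no_frame; [exact: box_gpt|exact: box_symmetry|].
  by move=> g h; exact: Zp_mulgC.
Qed.
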